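(* Let $G$ be a finite simple graph of order $n \geq 12$. If $G$ is minimal $(n-10)$-factor-critical, then $\delta(G) = n-9$, where $\delta(G)$ denotes the minimum degree of $G$.
   Context: All graphs are finite and simple. A graph $G$ of order $n$ is $k$-factor-critical (for an integer $1 \leq k < n$) if for every set $S \subseteq V(G)$ with $|S| = k$, the graph $G - S$ has a perfect matching. A $k$-factor-critical graph $G$ is minimal $k$-factor-critical if for every edge $e \in E(G)$, the graph $G - e$ (same vertex set, edge $e$ removed) is not $k$-factor-critical. *)

(* Defs.v *)
(* A finite simple graph on the vertex type T : finType is a
   relation e : rel T together with hypotheses symmetric e, irreflexive e. *)
From mathcomp Require Import all_boot.

Set Implicit Arguments.
Unset Strict Implicit.
Unset Printing Implicit Defensive.

Section GraphDefs.
Variables (T : finType) (e : rel T).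

Definition edges : {set {set T}} :=
  [set [set p.1; p.2] | p : T * T & e p.1 p.2].

Definition del_edge (f : {set T}) : rel T :=
  [rel x y | e x y && ([set x; y] != f)].

(* M is a perfect matching of the subgraph induced by A: a set of edges that
   partitions A (hence pairwise disjoint, contained in A and covering A).
   The graph G - S is the subgraph induced by ~: S. *)
Definition perfect_matching (A : {set T}) (M : {set {set T}}) : bool :=
  (M \subset edges) && partition M A.

Definition factor_critical (k : nat) : Prop :=
  1 <= k < #|T| /\
  forall S : {set T}, #|S| = k -> exists M, perfect_matching (~: S) M.

Definition degree (x : T) : nat := #|[set y | e x y]|.

(* Every degree is less than #|T|, so for a nonempty graph the default value
   #|T| does not affect the minimum. *)
Definition min_degree : nat := \big[minn/#|T|]_(x : T) degree x.

End GraphDefs.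

Definition minimal_factor_critical (T : finType) (e : rel T) (k : nat) : Prop :=
  factor_critical e k /\
  forall f : {set T}, f \in edges e -> ~ factor_critical (del_edge e f) k.

(* Main.v *)
Require Import Defs.
From mathcomp Require Import all_boot.
From mathcomp Require Import zify.

Set Implicit Arguments.
Unset Strict Implicit.
Unset Printing Implicit Defensive.

(* Let h be the complement of the graph.  By Tutte's theorem, a 10-set of vertices
   has no perfect matching exactly when h restricted to it contains a complete multipartite
   graph with at least two parts, all of odd size, in which the sum of (size + 1) over the
   parts is at least 12; trimming the parts makes this sum equal to 12.  So h contains no
   such graph (a star with 9 leaves is one, whence the lower bound on the degrees), but by
   minimality h + uw contains one for each nonedge uw of h.

   Suppose now that h has maximum degree at most 7, and let K be a copy of a given shape in
   h + uw.  The vertices of K have few neighbours outside K, so for a small subset A of K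
   some z outside K is adjacent to no vertex of A.  Take x in K not adjacent to z: the copy
   in h + xz and the graph on K and z overlap in finitely many ways, and for suitable A and
   x each of them yields a vertex of degree at least 8 or a forbidden subgraph of h.  This
   excludes the shapes one after the other, with each exclusion helping the next ones, until
   only (1,1,7) and (5,5) are left.  In a copy of (5,5) the same argument applied to a pair
   inside the part of u shows that u is adjacent to all of its part, hence to 8 vertices;
   with (5,5) gone, (1,1,7) is excluded like the other shapes. *)

(** * Completing an odd multipartite graph by one edge *)

Section Colouring.
Variables (T : finType) (h : rel T).

Definition link (u w : T) : rel T :=
  [rel a b | [|| h a b, (a == u) && (b == w) | (a == w) && (b == u)]].

(* [f a = i] puts [a] in part [i]; the value [size sh] stands for the vertices outside
   the copy. *)
Definition colouring (r : rel T) (sh : seq nat) (f : T -> nat) : Prop :=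
  [/\ forall a, f a <= size sh,
      forall i, i < size sh -> #|[pred a | f a == i]| = nth 0 sh i &
      forall a b, f a < size sh -> f b < size sh -> f a != f b -> r a b].

Definition pattern (sh : seq nat) (u w : T) : Prop :=
  exists f, [/\ colouring (link u w) sh f, f u = 0, f w = 1 & 1 < size sh].

Definition multipartite (ps : seq (seq T)) : bool :=
  uniq (flatten ps) && pairwise (fun p q => all (fun a => all (h a) q) p) ps.

Lemma card_coloured r sh f : colouring r sh f ->
  #|[pred a | f a < size sh]| = sumn sh.
Proof.
case=> _ cf _.
suff: forall n, n <= size sh -> #|[pred a | f a < n]| = sumn (take n sh).
  by move/(_ _ (leqnn _)); rewrite take_size.
elim=> [|n IHn] ltn; first by rewrite take0; apply/eq_card0.
rewrite (take_nth 0) // sumn_rcons -IHn ?(ltnW ltn) // -cf //.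
rewrite -cardUI (@eq_card0 _ [predI _ & _]) ?addn0 => [|a]; last first.
  by rewrite !inE; case: ltngtP.
by apply: eq_card => a; rewrite !inE ltnS leq_eqVlt orbC.
Qed.

Lemma pattern_swap a b r u w : pattern [:: a, b & r] u w -> pattern [:: b, a & r] w u.
Proof.
case=> f [[f_le fc fr] fu fw _].
pose s i := if i == 0 then 1 else if i == 1 then 0 else i.
have s_inv i : s (s i) = i by rewrite /s; case: i => [|[|i]].
have s_lt i : (s i < (size r).+2) = (i < (size r).+2) by case: i => [|[|i]].
have s_eq i j : (s i == j) = (i == s j).
  by apply/eqP/eqP => [<-|->]; rewrite s_inv.
exists (s \o f); split=> //=; [split=> /= | by rewrite fw | by rewrite fu].
- by move=> y; rewrite -ltnS; have := f_le y; rewrite -ltnS /=; case: (f y) => [|[|i]].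
- move=> i lti; rewrite (@eq_card _ _ [pred y | f y == s i]); last first.
    by move=> y; rewrite !inE s_eq.
  by rewrite fc /= ?s_lt //; case: i {lti} => [|[|i]].
move=> y z; rewrite !s_lt => ly lz neq; have {}neq: f y != f z.
  by apply: contraNneq neq => ->.
by rewrite /link /=; case/or3P: (fr y z ly lz neq) => /= ->; rewrite ?orbT.
Qed.
End Colouring.

Inductive status := Adj | Non | Unk.

Section Search.
Variables (C : Type) (st : C -> C -> status) (sh : seq nat).
Local Notation np := (size sh).
Local Notation total := (sumn sh).

(* The search places known vertices, one after the other, in the parts of a copy of [sh] in
   h + xz.  An assignment lists for each placed vertex its part and its remaining capacity:
   how many further neighbours it may have in its own part or outside the copy, its
   neighbours in the other parts being already counted in the degree bound 7. *)
Definition same_or_unused (i j : nat) : bool := [|| eqn i np, eqn j np | eqn i j].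

Definition charge (i c : nat) : option nat :=
  if eqn i np then Some c else if c is c'.+1 then Some c' else None.

Fixpoint update (i : nat) (row : seq status) (asg : seq (nat * nat)) (c : nat) :
    option (seq (nat * nat) * nat) :=
  match row, asg with
  | s :: row', (j, d) :: asg' =>
    match s, same_or_unused i j with
    | Adj, true =>
      if charge i c is Some c1 then
        if charge j d is Some d1 then
          if update i row' asg' c1 is Some (a, c2) then Some ((j, d1) :: a, c2)
          else None
        else None
      else None
    | Non, false => None
    | _, _ =>
      if update i row' asg' c is Some (a, c1) then Some ((j, d) :: a, c1) else None
    end
  | _, _ => Some ([::], c)
  end.

Definition joined (M : seq (seq status)) (parts : seq nat) (a b : nat) : bool :=
  match nth Unk (nth [::] M a) b with
  | Adj => true
  | Non => false
  | Unk => ~~ same_or_unused (nth np parts a) (nth np parts b)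
  end.

Definition adjacency M parts : seq bitseq :=
  mkseq (fun a => mkseq (joined M parts a) (size parts)) (size parts).

End Search.

(* Only the answers of [choose] and [find_parts] matter, not their completeness: what they
   find is checked by [complete]. *)
Fixpoint choose (need k : nat) (cand : seq (nat * bitseq)) (com : bitseq) (acc : seq nat)
    (cont : bitseq -> seq nat -> option (seq (seq nat))) : option (seq (seq nat)) :=
  if k is k'.+1 then
    (fix go (cand : seq (nat * bitseq)) :=
      if cand is (i, r) :: cand' then
        let com' := [seq p.1 && p.2 | p <- zip com r] in
        if need <= count id com' then
          if choose need k' cand' com' (i :: acc) cont is Some res then Some res
          else go cand'
        else go cand'
      else None) cand
  else cont com acc.

Fixpoint find_parts (total : nat) (rows : seq (nat * (nat * bitseq))) (sh : seq nat)
    (com : bitseq) : option (seq (seq nat)) :=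
  if sh is s :: sh' then
    choose (sumn sh') s [seq p.2 | p <- rows & (total - s <= p.1) && nth false com p.2.1]
      com [::] (fun com' acc => omap (cons acc) (find_parts total rows sh' com'))
  else Some [::].

Definition family : seq (seq nat) :=
  [:: [:: 3; 7]; [:: 1; 1; 1; 5]; [:: 1; 1; 3; 3]; [:: 1; 1; 1; 1; 3]; [:: 3; 3; 3];
      [:: 5; 5]; [:: 1; 1; 1; 1; 1; 1]].

Definition complete (rows : seq bitseq) (ps : seq (seq nat)) : bool :=
  [&& uniq (flatten ps), all (fun a => a < size rows) (flatten ps) &
      pairwise (fun p q => all (fun a => all (nth false (nth [::] rows a)) q) p) ps].

Definition has_family (rows : seq bitseq) : bool :=
  let cands := zip (map (count id) rows) (zip (iota 0 (size rows)) rows) in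
  has (fun F =>
    if find_parts (sumn F) cands F (nseq (size rows) true) is Some ps then
      (map size ps == F) && complete rows ps
    else false) family.

Section Refute.
Variables (C : Type) (st : C -> C -> status) (sh : seq nat).
Local Notation np := (size sh).
Local Notation total := (sumn sh).

(* [slots] gives the number of places not yet filled in each part.  At a leaf these are
   taken by unnamed vertices, of which only the edges between distinct parts are known. *)
Definition leaf (M : seq (seq status)) (slots : seq nat) (asg : seq (nat * nat)) : bool :=
  let unnamed := flatten (mkseq (fun i => nseq (nth 0 slots i) i) np) in
  has_family (adjacency sh M ([seq p.1 | p <- asg] ++ unnamed)).

Fixpoint search (M rows : seq (seq status)) (slots : seq nat) (asg : seq (nat * nat)) :
    bool :=
  if rows is row :: rows' then
    all (fun i =>
      if eqn i np then
        if update sh i row asg 0 is Some (a, c) then search M rows' slots ((i, c) :: a)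
        else true
      else if nth 0 slots i is s.+1 then
        if update sh i row asg (7 - (total - nth 0 sh i)) is Some (a, c) then
          search M rows' (set_nth 0 slots i s) ((i, c) :: a)
        else true
      else true) (iota 0 np.+1)
  else leaf M slots asg.

Lemma search_cons M row rows slots asg : search M (row :: rows) slots asg =
  all (fun i =>
    if eqn i np then
      if update sh i row asg 0 is Some (a, c) then search M rows slots ((i, c) :: a)
      else true
    else if nth 0 slots i is s.+1 then
      if update sh i row asg (7 - (total - nth 0 sh i)) is Some (a, c) then
        search M rows (set_nth 0 slots i s) ((i, c) :: a)
      else true
    else true) (iota 0 np.+1).
Proof. by []. Qed.

Fixpoint status_rows (done rest : seq C) : seq (seq status) :=
  if rest is c :: rest' then map (st c) done :: status_rows (c :: done) rest' else [::].

(* The capacities of [x] and [z] are one larger because the edge xz is not in h. *)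
Definition refuted (x z : C) (rest : seq C) : bool :=
  let all_codes := catrev rest [:: z; x] in
  search [seq map (st a) all_codes | a <- all_codes] (status_rows [:: z; x] rest)
    (set_nth 0 (set_nth 0 sh 0 (nth 0 sh 0).-1) 1 (nth 0 sh 1).-1)
    [:: (1, 8 - (total - nth 0 sh 1)); (0, 8 - (total - nth 0 sh 0))].
End Refute.

Arguments search : simpl never.

Definition neighbours_le (T : finType) (h : rel T) (d : nat) : Prop :=
  forall a, #|[pred b | h a b]| <= d.

Definition family_free (T : finType) (h : rel T) : Prop :=
  forall ps, map size ps \in family -> ~~ multipartite h ps.

Section Soundness.
Variables (T : finType) (h : rel T).
Hypotheses (h_sym : symmetric h) (h_deg : neighbours_le h 7) (h_free : family_free h).
Variables (sh : seq nat) (f : T -> nat) (x z : T).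
Local Notation np := (size sh).
Local Notation total := (sumn sh).
Hypotheses (f_col : colouring (link h x z) sh f) (fx : f x = 0) (fz : f z = 1).

Definition spoils (w y : T) : bool := h w y && same_or_unused sh (f w) (f y).
Definition capacity (w : T) : nat :=
  (if w \in [:: x; z] then 8 else 7) - (total - nth 0 sh (f w)).

Lemma same_or_unusedC i j : same_or_unused sh i j = same_or_unused sh j i.
Proof. by rewrite /same_or_unused !eqnE orbCA (eq_sym i j). Qed.

Lemma f_le a : f a <= np. Proof. by case: f_col. Qed.

Lemma xDz : x != z.
Proof. by apply/eqP => xz; move: fz; rewrite -xz fx. Qed.

Lemma spoils_others_le w : f w < np ->
  #|spoils w| + (total - nth 0 sh (f w)) <= 7 + (w \in [:: x; z]).
Proof.
move=> lt_fw; have [_ fc fr] := f_col.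
pose others := [pred y | (f y < np) && (f y != f w)].
have card_others : #|others| = total - nth 0 sh (f w).
  rewrite -(card_coloured f_col) -fc //.
  rewrite -(cardID [pred y | f y == f w] [pred y | f y < np]).
  rewrite (@eq_card _ [predI _ & _] [pred y | f y == f w]) ?addKn => [|y].
    by apply: eq_card => y; rewrite !inE andbC.
  by rewrite !inE; case: eqP => [->|]; rewrite ?lt_fw ?andbF.
have disj : #|spoils w| + #|[pred y | h w y & y \in others]| <= 7.
  apply: leq_trans (h_deg w); rewrite -cardUI addnC eq_card0 => [|y]; last first.
    apply/negP; rewrite !inE /in_mem /= /spoils /same_or_unused !eqnE (ltn_eqF lt_fw) /=.
    rewrite (eq_sym (f y)) => /andP[/andP[_ /orP[]/eqP yE]].
      by rewrite yE ltnn !andbF.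
    by rewrite yE eqxx !andbF.
  by apply/subset_leq_card/subsetP => y; rewrite !inE => /orP[] /andP[].
have le_others : total - nth 0 sh (f w) <=
    #|[pred y | h w y & y \in others]| + (w \in [:: x; z]).
  rewrite -card_others -(cardID [pred y | h w y] others) leq_add //.
    by apply/subset_leq_card/subsetP => y; rewrite !inE andbC.
  have missing y : y \in [predD others & [pred y | h w y]] ->
      (w == x) && (y == z) || (w == z) && (y == x).
    rewrite !inE => /and3P[nh lt_fy neq].
    rewrite eq_sym in neq.
    case/or3P: (fr w y lt_fw lt_fy neq) => [hwy|->//|->]; last by rewrite orbT.
    by case/negP: nh.
  have [w_in|w_out] := boolP (w \in [:: x; z]).
    apply: (@leq_trans #|pred1 (if w == x then z else x)|); last by rewrite card1.
    apply/subset_leq_card/subsetP => y /missing; rewrite !inE.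
    case: eqP => [->|_] /=; last by case/andP.
    by rewrite (negPf xDz) orbF.
  rewrite leqn0; apply/eqP/eq_card0 => y; apply/negP => /missing.
  by case/orP => /andP[wE _]; case/negP: w_out; rewrite !inE wE ?orbT.
by move: disj le_others; case: (w \in _) => /=; lia.
Qed.

Lemma spoils_le_capacity w : f w < np -> #|spoils w| <= capacity w.
Proof.
by move/spoils_others_le; rewrite /capacity; case: (w \in _) => /=; lia.
Qed.

Lemma count_spoils w s : uniq s -> f w < np -> count (spoils w) s <= capacity w.
Proof.
move=> s_uniq lt_fw; apply: leq_trans (spoils_le_capacity lt_fw).
rewrite -size_filter -(card_uniqP (filter_uniq _ s_uniq)).
by apply/subset_leq_card/subsetP => y; rewrite mem_filter => /andP[].
Qed.

Definition status_ok (a : T) (s : status) (b : T) : bool :=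
  match s with Adj => h a b | Non => ~~ h a b | Unk => true end.

Arguments status_ok _ !s _ /.

Definition tracks (seen : seq T) (asg : seq (nat * nat)) (vs : seq T) : bool :=
  all2 (fun p w =>
    (p.1 == f w) && ((f w < np) ==> (capacity w <= p.2 + count (spoils w) seen))) asg vs.

Lemma update_sound y seen : uniq (y :: seen) -> y \notin [:: x; z] ->
  forall vs row asg c, all2 (status_ok y) row vs -> tracks seen asg vs ->
  (f y < np -> count (spoils y) vs <= c) ->
  exists a c', [/\ update sh (f y) row asg c = Some (a, c'), tracks (y :: seen) a vs &
    f y < np -> c <= c' + count (spoils y) vs].
Proof.
move=> seen_uniq y_new; elim=> [|w vs IHvs] [|s row] [|[j d] asg] c //=.
  by exists [::], c; split=> // _; rewrite addn0.
case/andP=> s_ok row_ok /andP[/andP[/eqP -> d_ok] asg_ok] c_ok.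
have spoilsC : spoils w y = spoils y w by rewrite /spoils h_sym same_or_unusedC.
have keep : exists a c', [/\ (if update sh (f y) row asg c is Some (a, c1)
    then Some ((f w, d) :: a, c1) else None) = Some (a, c'), tracks (y :: seen) a (w :: vs) &
    f y < np -> c <= c' + (spoils y w + count (spoils y) vs)].
  have [lt_fy|a [c1 [-> a_ok c1_ok]]] := IHvs row asg c row_ok asg_ok.
    exact: leq_trans (leq_addl _ _) (c_ok lt_fy).
  exists ((f w, d) :: a), c1; split=> //=.
    rewrite a_ok andbT eqxx; apply/implyP => /(implyP d_ok) /leq_trans-> //.
    by rewrite leq_add2l leq_addl.
  by move=> /c1_ok /leq_trans-> //; rewrite leq_add2l leq_addl.
case sameE : (same_or_unused sh (f y) (f w)); last first.
  case: s s_ok => //= nhyw; case/negP: nhyw.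
  move: sameE; rewrite /same_or_unused !eqnE; case/norP=> ne_y /norP[ne_w neq].
  have /or3P[//|/andP[yE _]|/andP[yE _]] : link h x z y w.
  - by case: f_col => _ _; apply; rewrite // ltn_neqAle f_le andbT.
  - by case/negP: y_new; rewrite !inE yE.
  - by case/negP: y_new; rewrite !inE yE orbT.
have spoils_yw : spoils y w = h y w by rewrite /spoils sameE andbT.
case: s s_ok => //= s_ok.
rewrite spoils_yw s_ok add1n in c_ok *.
have [c1 chargec c1E] : exists2 c1, charge sh (f y) c = Some c1 & f y < np -> c = c1.+1.
  rewrite /charge eqnE; case: eqP => [->|/eqP ne]; first by exists c; rewrite ?ltnn.
  have lt_fy : f y < np by rewrite ltn_neqAle ne f_le.
  by case: (c) (c_ok lt_fy) => // c1 _; exists c1.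
have [d1 charged d1E] : exists2 d1, charge sh (f w) d = Some d1 & f w < np -> d = d1.+1.
  rewrite /charge eqnE; case: eqP => [->|/eqP ne]; first by exists d; rewrite ?ltnn.
  have lt_fw : f w < np by rewrite ltn_neqAle ne f_le.
  have := leq_trans (count_spoils seen_uniq lt_fw) (implyP d_ok lt_fw).
  by rewrite /= spoilsC spoils_yw s_ok leq_add2r; case: (d) => // d1 _; exists d1.
rewrite chargec charged.
have [lt_fy|a [c2 [-> a_ok c2_ok]]] := IHvs row asg c1 row_ok asg_ok.
  by rewrite -ltnS -c1E // c_ok.
exists ((f w, d1) :: a), c2; split=> //=.
  rewrite a_ok andbT eqxx spoilsC spoils_yw s_ok; apply/implyP => lt_fw.
  by rewrite addnA addn1 -d1E //; apply: (implyP d_ok).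
by move=> lt_fy; rewrite c1E // addnS ltnS c2_ok.
Qed.

Fixpoint rows_ok (seen rest : seq T) (rows : seq (seq status)) : bool :=
  match rest, rows with
  | y :: rest', row :: rows' => all2 (status_ok y) row seen && rows_ok (y :: seen) rest' rows'
  | [::], [::] => true
  | _, _ => false
  end.

Definition slots_ok (seen : seq T) (slots : seq nat) : Prop :=
  forall i, i < np -> nth 0 slots i + count (fun y => f y == i) seen = nth 0 sh i.

Lemma count_part s i : uniq s -> i < np -> count (fun y => f y == i) s <= nth 0 sh i.
Proof.
move=> s_uniq lt_i; case: f_col => _ <- // _.
rewrite -size_filter -(card_uniqP (filter_uniq _ s_uniq)).
by apply/subset_leq_card/subsetP => y; rewrite mem_filter => /andP[].
Qed.

Lemma tracks_parts seen asg vs : tracks seen asg vs -> map fst asg = map f vs.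
Proof. by elim: vs asg => [|v vs IH] [|p asg] //= /andP[/andP[/eqP-> _] /IH->]. Qed.

Lemma search_sound M : forall rest seen rows slots asg,
  uniq (catrev rest seen) -> x \in seen -> z \in seen -> rows_ok seen rest rows ->
  tracks seen asg seen -> slots_ok seen slots -> search sh M rows slots asg ->
  exists slots' asg', [/\ leaf sh M slots' asg',
    map fst asg' = map f (catrev rest seen) & slots_ok (catrev rest seen) slots'].
Proof.
elim=> [|y rest IHrest] seen [|row rows] slots asg //.
  by move=> _ _ _ _ /tracks_parts asgE ? ?; exists slots, asg.
move=> all_uniq x_in z_in /andP[row_ok rows_oks] asg_ok slots_okP.
rewrite search_cons => /allP/(_ (f y)) searched.
have seen_uniq : uniq (y :: seen).
  by move: all_uniq; rewrite /= catrevE cat_uniq => /and3P[].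
have y_new : y \notin [:: x; z].
  by rewrite !inE; apply: contraL seen_uniq => /orP[]/eqP-> /=; rewrite ?x_in ?z_in.
move: searched; rewrite mem_iota /= ltnS f_le eqnE => /(_ isT).
have c_ok c : (f y < np -> capacity y <= c) -> f y < np -> count (spoils y) seen <= c.
  move=> le_c lt_fy; apply: leq_trans (le_c lt_fy).
  by apply: count_spoils => //; case/andP: seen_uniq.
case: eqP => [fy|/eqP fyN].
  have [|a [c' [-> a_ok _]]] := update_sound seen_uniq y_new (c := 0) row_ok asg_ok.
    by rewrite fy ltnn.
  apply: IHrest => //=; rewrite ?inE ?x_in ?z_in ?orbT //.
    by rewrite a_ok andbT eqxx fy ltnn.
  move=> i lt_i; rewrite /= fy (gtn_eqF lt_i) add0n; exact: slots_okP.
have lt_fy : f y < np by rewrite ltn_neqAle fyN f_le.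
have : 0 < nth 0 slots (f y).
  by have := count_part seen_uniq lt_fy; rewrite /= eqxx -(slots_okP _ lt_fy) leq_add2r.
case slotE: (nth 0 slots (f y)) => [//|k] _.
have [|a [c' [-> a_ok c'_ok]]] := update_sound seen_uniq y_new (c := 7 - (total - nth 0 sh (f y)))
  row_ok asg_ok.
  by apply: c_ok => _; rewrite /capacity (negPf y_new).
apply: IHrest => //=; rewrite ?inE ?x_in ?z_in ?orbT //.
  rewrite a_ok andbT eqxx lt_fy /= /capacity (negPf y_new).
  by apply: leq_trans (c'_ok lt_fy) _; rewrite leq_add2l leq_addl.
move=> i lt_i; rewrite /= nth_set_nth /= -(slots_okP _ lt_i) (eq_sym (f y)).
by have [->|_] := eqVneq i (f y); rewrite ?add0n // slotE addnCA add1n addSn.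
Qed.

Definition unseen (s : seq T) (i : nat) : seq T := [seq y <- enum T | (f y == i) && (y \notin s)].

Lemma map_unseen s slots : uniq s -> slots_ok s slots ->
  map f (flatten (mkseq (unseen s) np)) = flatten (mkseq (fun i => nseq (nth 0 slots i) i) np).
Proof.
move=> s_uniq s_ok; rewrite map_flatten /mkseq -map_comp; congr flatten.
apply/eq_in_map => i; rewrite mem_iota /= => lt_i.
have -> : nth 0 slots i = size (unseen s i).
  apply: (@addIn (count (fun y => f y == i) s)); rewrite s_ok //.
  case: f_col => _ <- // _; rewrite -(cardID (mem s)) addnC; congr (_ + _).
    rewrite -(card_uniqP (filter_uniq _ (enum_uniq T))).
    by apply: eq_card => y; rewrite !inE mem_filter mem_enum andbT andbC.
  rewrite -size_filter -(card_uniqP (filter_uniq _ s_uniq)).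
  by apply: eq_card => y; rewrite !inE mem_filter.
rewrite -(size_map f); apply/all_pred1P/allP => _ /mapP[y + ->].
by rewrite mem_filter => /andP[/andP[/eqP-> _] _] /=.
Qed.

Lemma unseen_uniq s n : uniq s -> uniq (s ++ flatten (mkseq (unseen s) n)).
Proof.
move=> s_uniq; suff: uniq (flatten (mkseq (unseen s) n)) /\
    forall y, y \in flatten (mkseq (unseen s) n) -> f y < n /\ y \notin s.
  case=> u_uniq u_new; rewrite cat_uniq s_uniq u_uniq andbT.
  by apply/hasPn => y /u_new[].
elim: n => [|n [u_uniq u_new]]; first by split.
rewrite mkseqS flatten_rcons; split=> [|y]; last first.
  rewrite mem_cat => /orP[/u_new[/ltnW lt_n ?]|]; first by split.
  by rewrite mem_filter => /andP[/andP[/eqP-> ?] _].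
rewrite cat_uniq u_uniq filter_uniq ?enum_uniq // andbT.
apply/hasPn => y; rewrite mem_filter => /andP[/andP[/eqP fy _] _].
by apply/negP => /u_new[]; rewrite fy ltnn.
Qed.

Lemma complete_multipartite rows ps V : uniq V -> size V = size rows ->
  (forall a b, a < size V -> b < size V -> a != b ->
     nth false (nth [::] rows a) b -> h (nth x V a) (nth x V b)) ->
  complete rows ps -> multipartite h [seq [seq nth x V a | a <- p] | p <- ps].
Proof.
move=> V_uniq sizeV rows_ok /and3P[ps_uniq /allP ps_lt ps_adj].
have nth_inj : {in flatten ps &, injective (nth x V)}.
  move=> a b /ps_lt lt_a /ps_lt lt_b /eqP.
  by rewrite nth_uniq ?sizeV // => /eqP.
apply/andP; split; first by rewrite -map_flatten map_inj_in_uniq.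
rewrite pairwise_map; elim: ps ps_uniq ps_lt ps_adj {nth_inj} => [|p ps IHps] //=.
rewrite cat_uniq => /and3P[p_uniq /hasPn disj ps_uniq] ps_lt /andP[/allP p_adj ps_adj].
rewrite IHps ?andbT // => [|a a_in]; last by rewrite ps_lt // mem_cat a_in orbT.
apply/allP => q q_in; apply/allP => _ /mapP[a a_in ->]; apply/allP => _ /mapP[b b_in ->].
have b_in' : b \in flatten ps by apply/flattenP; exists q.
apply: rows_ok; rewrite ?sizeV ?ps_lt ?mem_cat ?a_in ?b_in' ?orbT //.
  by apply: contraNneq (disj b b_in') => <-.
by have /allP/(_ a a_in)/allP/(_ b b_in) := p_adj q q_in.
Qed.

Variables (C : Type) (st : C -> C -> status) (cd : T -> C).
Hypotheses (st_xz : st (cd x) (cd z) = Non) (st_zx : st (cd z) (cd x) = Non).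

Lemma leaf_sound D slots asg : uniq D -> x \in D -> z \in D ->
  (forall a b, a \in D -> b \in D -> a != b -> status_ok a (st (cd a) (cd b)) b) ->
  map fst asg = map f D -> slots_ok D slots ->
  ~~ leaf sh [seq [seq st (cd a) (cd b) | b <- D] | a <- D] slots asg.
Proof.
move=> D_uniq x_in z_in st_ok asgE slotsP; rewrite /leaf asgE -(map_unseen D_uniq slotsP) -map_cat.
set V := D ++ _; have V_uniq : uniq V by exact: unseen_uniq.
set M := map _ D.
apply/hasPn => F F_in; case: find_parts => // ps; apply/negP => /andP[/eqP shapeE ps_ok].
suff: multipartite h [seq [seq nth x V a | a <- p] | p <- ps].
  apply/negP; apply: h_free; rewrite -map_comp (eq_map (g := size)) ?shapeE // => p.
  by rewrite /= size_map.
apply: complete_multipartite ps_ok; rewrite // ?size_mkseq ?size_map //.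
move=> a b lt_a lt_b aDb; rewrite /adjacency size_map !nth_mkseq // /joined.
set a' := nth x V a; set b' := nth x V b.
have a'Db' : a' != b' by rewrite nth_uniq.
have statusE : nth Unk (nth [::] M a) b =
    if (a < size D) && (b < size D) then st (cd a') (cd b') else Unk.
  rewrite /a' /b' !nth_cat; case: ltnP => [lt_aD|le_aD] /=; last first.
    by rewrite (nth_default [::]) ?size_map // nth_nil.
  rewrite (nth_map x) //; case: ltnP => [lt_bD|le_bD]; first by rewrite (nth_map x).
  by rewrite nth_default ?size_map.
have in_D c : c < size D -> nth x V c \in D by move=> lt_c; rewrite nth_cat lt_c mem_nth.
have by_parts : ~~ ((a' == x) && (b' == z)) -> ~~ ((a' == z) && (b' == x)) ->
    ~~ same_or_unused sh (nth np (map f V) a) (nth np (map f V) b) -> h a' b'.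
  move=> not_xz not_zx; rewrite !(nth_map x) // /same_or_unused !eqnE.
  case/norP=> ne_a /norP[ne_b neq].
  have /or3P[//|xz|zx] : link h x z a' b'.
  - by case: f_col => _ _; apply; rewrite // ltn_neqAle f_le andbT.
  - by case/negP: not_xz.
  - by case/negP: not_zx.
rewrite statusE; case: ifP => [/andP[lt_aD lt_bD]|in_DF].
  have := st_ok a' b' (in_D _ lt_aD) (in_D _ lt_bD) a'Db'.
  case stE: (st _ _) => //= _; apply: by_parts.
    by apply/negP => /andP[/eqP ax /eqP bz]; rewrite ax bz st_xz in stE.
  by apply/negP => /andP[/eqP az /eqP bx]; rewrite az bx st_zx in stE.
have out_D c : nth x V c \in D -> c < size V -> c < size D.
  rewrite nth_cat; case: ltnP => // le_c; move: V_uniq; rewrite /V cat_uniq.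
  case/and3P=> _ /hasPn disj _ c_in; rewrite size_cat -ltn_subLR // => lt_c.
  by have := disj _ (mem_nth x lt_c); rewrite c_in.
apply: by_parts; apply/negP => /andP[/eqP aE /eqP bE]; move: in_DF;
  by rewrite (out_D a) ?(out_D b) // -/a' -/b' ?aE ?bE.
Qed.

Lemma status_rows_ok seen rest :
  (forall a b, a \in catrev rest seen -> b \in catrev rest seen -> a != b ->
     status_ok a (st (cd a) (cd b)) b) ->
  uniq (catrev rest seen) -> rows_ok seen rest (status_rows st (map cd seen) (map cd rest)).
Proof.
elim: rest seen => [|y rest IHrest] seen //= st_ok all_uniq.
rewrite -map_cons IHrest // andbT.
have in_all a : a \in y :: seen -> a \in catrev rest (y :: seen).
  by rewrite catrevE mem_cat => ->; rewrite orbT.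
have y_notin : y \notin seen by move: all_uniq; rewrite catrevE cat_uniq => /and3P[_ _ /andP[]].
suff row_ok vs : {subset vs <= seen} -> all2 (status_ok y) (map (st (cd y)) (map cd vs)) vs.
  by apply: row_ok.
elim: vs => //= w vs IHvs vs_sub; rewrite IHvs ?andbT => [|v v_in]; last first.
  by rewrite vs_sub // inE v_in orbT.
have w_in : w \in seen by rewrite vs_sub ?mem_head.
have yDw : y != w by apply: contraNneq y_notin => ->.
by apply: st_ok yDw; rewrite in_all // inE ?eqxx ?w_in ?orbT.
Qed.

Lemma refuted_sound rest : 1 < np -> uniq [:: x, z & rest] ->
  (forall a b, a \in [:: x, z & rest] -> b \in [:: x, z & rest] -> a != b ->
     status_ok a (st (cd a) (cd b)) b) ->
  ~~ refuted st sh (cd x) (cd z) (map cd rest).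
Proof.
move=> np_gt1 all_uniq st_ok; set D := catrev rest [:: z; x].
have permD : perm_eq D [:: x, z & rest].
  rewrite /D catrevE perm_catC -[[:: x, z & rest]]/([:: x; z] ++ rest) perm_cat //.
    by rewrite (perm_catC [:: z] [:: x]).
  by rewrite perm_rev.
have D_uniq : uniq D by rewrite (perm_uniq permD).
have {}st_ok a b : a \in D -> b \in D -> a != b -> status_ok a (st (cd a) (cd b)) b.
  by rewrite !(perm_mem permD); apply: st_ok.
have x_in : x \in D by rewrite (perm_mem permD) mem_head.
have z_in : z \in D by rewrite (perm_mem permD) !inE eqxx orbT.
apply/negP => searched.
have codesE : catrev (map cd rest) [:: cd z; cd x] = map cd D.
  by rewrite /D !catrevE map_cat map_rev.
move: searched; rewrite /refuted codesE -map_comp.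
rewrite (eq_map (g := fun a => [seq st (cd a) (cd b) | b <- D])) => [searched|a]; last first.
  by rewrite /= -map_comp.
have [|||||slots [asg [leafd asgE slotsP]]] := search_sound D_uniq _ _ _ _ _ searched.
- by rewrite !inE eqxx orbT.
- by rewrite mem_head.
- exact: (@status_rows_ok [:: z; x]).
- rewrite /= fx fz !eqxx /= np_gt1 (ltn_trans _ np_gt1) //= /capacity !inE !eqxx orbT fx fz.
  by rewrite !leq_addr.
- move=> i lt_i; rewrite !nth_set_nth /= fx fz addn0.
  have count_ge1 j y : f y = j -> 0 < #|[pred a | f a == j]|.
    by move=> fy; apply/card_gt0P; exists y; rewrite inE fy.
  case: f_col => _ fc _; case: i lt_i => [|[|i]] lt_i //=.
  + by have := count_ge1 _ _ fx; rewrite fc // nth_set_nth /=; lia.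
  + by have := count_ge1 _ _ fz; rewrite fc //; lia.
  + by rewrite nth_set_nth /= !addn0.
by case/negP: (leaf_sound D_uniq x_in z_in st_ok asgE slotsP).
Qed.
End Soundness.

(** * Eliminating the shapes *)

(* A copy of [sh] in h + uw is cut into blocks: {u}, the rest of part 0, {w}, the rest of
   part 1, and the other parts. *)
Definition block_part (b : nat) : nat := if b < 2 then 0 else if b < 4 then 1 else b - 2.

Definition block_status (b c : nat) : status :=
  if eqn (block_part b) (block_part c) then Unk
  else if eqn b 0 && eqn c 2 || eqn b 2 && eqn c 0 then Non else Adj.

Definition blocks (sh : seq nat) : seq nat :=
  if sh is a :: b :: r then [:: 1; a.-1; 1; b.-1] ++ r else [::].

Definition block_slack (sh : seq nat) (b : nat) : nat :=
  (if eqn b 0 || eqn b 2 then 8 else 7) - (sumn sh - nth 0 sh (block_part b)).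

(* [None] is the vertex z outside the copy; [Some (b, s)] is a vertex of block [b], adjacent
   to z iff [s]. *)
Definition code : Type := option (nat * bool).

Definition code_status (c d : code) : status :=
  match c, d with
  | None, None => Unk
  | None, Some (_, s) | Some (_, s), None => if s then Adj else Non
  | Some (b, _), Some (b', _) => block_status b b'
  end.

Definition code_eqb (c d : code) : bool :=
  match c, d with
  | None, None => true
  | Some (b, s), Some (b', s') => eqn b b' && eqb s s'
  | _, _ => false
  end.

(* Vertices of a block are interchangeable, so only the number of neighbours of z in each
   block matters; z avoids at least [nth 0 avoid b] vertices of block [b]. *)
Fixpoint codes (b : nat) (sizes avoid : seq nat) : seq (seq code) :=
  if sizes is n :: sizes' then
    flatten [seq [seq nseq k (Some (b, true)) ++ nseq (n - k) (Some (b, false)) ++ l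
                 | l <- codes b.+1 sizes' (behead avoid)]
            | k <- iota 0 (n - head 0 avoid).+1]
  else [:: [::]].

Definition is_adj (s : status) : bool := if s is Adj then true else false.

Definition overfull (cs : seq code) : bool :=
  has (fun c => 7 < count (fun d => is_adj (code_status c d)) cs) cs.

Fixpoint remove_code (c : code) (cs : seq code) : seq code :=
  if cs is d :: cs' then if code_eqb c d then cs' else d :: remove_code c cs' else [::].

Definition refuted_codes (shapes : seq (seq nat)) (tries : seq nat) (cs : seq code) : bool :=
  overfull (None :: cs) ||
  has (fun b => let c := Some (b, false) in has (code_eqb c) cs &&
    all (fun sh => refuted code_status sh c None (remove_code c cs)) shapes) tries.

(* The inequality ensures that fewer than [12 - sumn sh] vertices outside the copy have a
   neighbour among the avoided ones. *)
Definition refuted_shape (shapes : seq (seq nat)) (sh avoid tries : seq nat) : bool :=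
  (sumn [seq nth 0 avoid b * block_slack sh b | b <- iota 0 (size (blocks sh))]
     < 12 - sumn sh) &&
  all (refuted_codes shapes tries) (codes 0 (blocks sh) avoid).

Section Elimination.
Variables (T : finType) (h : rel T).
Hypotheses (h_sym : symmetric h) (h_deg : neighbours_le h 7) (h_free : family_free h).
Hypothesis T_ge12 : 12 <= #|T|.

Definition saturated (shapes : seq (seq nat)) : Prop :=
  forall x z, x != z -> ~~ h x z -> exists2 sh, sh \in shapes & pattern h sh x z.

Lemma code_eqP : Equality.axiom code_eqb.
Proof.
case=> [[b s]|] [[b' s']|] /=; try by constructor.
rewrite eqnE; apply: (iffP andP) => [[/eqP-> /eqP->] //|[-> ->]]; by split; apply/eqP.
Qed.

Definition first_adjacent (z : T) (s : seq T) : seq T :=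
  [seq y <- s | h z y] ++ [seq y <- s | ~~ h z y].

Lemma mem_codes (cd : T -> code) z : forall Bs b avoid,
  (forall k y, k < size Bs -> y \in nth [::] Bs k -> cd y = Some (b + k, h z y)) ->
  (forall k, k < size Bs ->
     count (h z) (nth [::] Bs k) <= size (nth [::] Bs k) - nth 0 avoid k) ->
  map cd (flatten (map (first_adjacent z) Bs)) \in codes b (map size Bs) avoid.
Proof.
elim=> [|B Bs IHBs] b avoid cdE le_count; first by rewrite inE.
have map_side (t : bool) : map cd [seq y <- B | h z y == t] =
    nseq (count (fun y => h z y == t) B) (Some (b, t)).
  rewrite -size_filter -(size_map cd); apply/all_pred1P/allP => _ /mapP[y + ->].
  rewrite mem_filter => /andP[/eqP hzy y_in] /=.
  by rewrite (cdE 0 y) ?addn0 ?hzy.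
apply/flattenP; exists [seq nseq (count (h z) B) (Some (b, true)) ++
  nseq (size B - count (h z) B) (Some (b, false)) ++ l
  | l <- codes b.+1 (map size Bs) (behead avoid)].
  apply/mapP; exists (count (h z) B) => //; rewrite mem_iota /= ltnS.
  by have := le_count 0 isT; rewrite /= nth0.
apply/mapP; exists (map cd (flatten (map (first_adjacent z) Bs))).
  apply: IHBs => [k y lt_k y_in|k lt_k]; first by rewrite addSnnS (cdE k.+1).
  by have := le_count k.+1 lt_k; rewrite nth_behead.
rewrite /= map_cat {1}/first_adjacent map_cat -catA; congr (_ ++ (_ ++ _)).
  rewrite (eq_filter (a2 := fun y => h z y == true)) ?map_side => [|y]; last by case: (h z y).
  by congr nseq; apply: eq_count => y; case: (h z y).
rewrite (eq_filter (a2 := fun y => h z y == false)) ?map_side => [|y]; last by case: (h z y).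
congr nseq; rewrite -(count_predC (h z) B) addKn; apply: eq_count => y /=.
by case: (h z y).
Qed.

Lemma remove_codeP (cd : T -> code) c vs : has (code_eqb c) (map cd vs) ->
  exists v vs', [/\ perm_eq vs (v :: vs'), cd v = c & remove_code c (map cd vs) = map cd vs'].
Proof.
elim: vs => //= v vs IHvs; case: code_eqP => [-> _|_ /= /IHvs[v' [vs' [vsE cdv ->]]]].
  by exists v, vs.
exists v', (v :: vs'); split=> //; rewrite -(perm_cons v) in vsE.
by apply: (perm_trans vsE); rewrite (perm_catCA [:: v] [:: v'] vs').
Qed.

Lemma overfull_sound (cd : T -> code) vs : uniq vs ->
  (forall a b, a \in vs -> b \in vs -> a != b -> status_ok h a (code_status (cd a) (cd b)) b) ->
  ~~ overfull (map cd vs).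
Proof.
move=> vs_uniq st_ok; apply/hasPn => _ /mapP[a a_in ->]; rewrite -leqNgt.
apply: leq_trans (h_deg a); rewrite count_map -size_filter.
rewrite -(card_uniqP (filter_uniq _ vs_uniq)).
apply/subset_leq_card/subsetP => b; rewrite mem_filter inE => /andP[/= adj b_in].
have aDb : a != b.
  apply: contraTneq adj => <-; case: (cd a) => [[i s]|] //=.
  by rewrite /block_status eqnE eqxx.
by have := st_ok a b a_in b_in aDb; case: (code_status _ _) adj.
Qed.

Section Blocks.
Variables (sh : seq nat) (f : T -> nat) (u w : T).
Hypotheses (f_col : colouring (link h u w) sh f) (fu : f u = 0) (fw : f w = 1).
Hypotheses (sh_gt1 : 1 < size sh) (nhuw : ~~ h u w).
Local Notation np := (size sh).
Local Notation nb := (size (blocks sh)).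

Definition block (y : T) : nat :=
  if y == u then 0 else if f y == 0 then 1 else if y == w then 2
  else if f y == 1 then 3 else f y + 2.

Lemma block_partE y : block_part (block y) = f y.
Proof.
rewrite /block; case: (eqVneq y u) => [->|_]; first by rewrite fu.
case: eqP => [->//|/eqP f0]; case: (eqVneq y w) => [->|_]; first by rewrite fw.
case: eqP => [->//|/eqP f1]; rewrite /block_part; move: f0 f1.
by case: (f y) => [|[|i]] // _ _; rewrite addn2.
Qed.

Lemma block0E y : (block y == 0) = (y == u).
Proof.
rewrite /block; case: (y == u) => //; case: (f y == 0) => //; case: (y == w) => //.
by case: (f y == 1) => //; rewrite addn2.
Qed.

Lemma block2E y : (block y == 2) = (y == w).
Proof.
have [->|yDw] := eqVneq y w.
  have [wu|wDu] := eqVneq w u; first by move: fw; rewrite wu fu.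
  by rewrite /block (negPf wDu) fw eqxx.
rewrite /block (negPf yDw); case: (y == u) => //; case: (f y =P 0) => // f0.
by case: (f y == 1) => //; apply/eqP; lia.
Qed.

Lemma block_statusP y y' : f y < np -> f y' < np -> y != y' ->
  status_ok h y (block_status (block y) (block y')) y'.
Proof.
move=> lt_y lt_y' yDy'; rewrite /block_status !eqnE !block_partE !block0E !block2E.
case: eqP => // /eqP neq; case: ifP => [/orP[] /andP[/eqP-> /eqP->]//=|notuw].
  by rewrite h_sym.
case: f_col => _ _ /(_ y y' lt_y lt_y' neq) /or3P[//|/= uw|wu].
  by rewrite uw in notuw.
by rewrite /= wu orbT in notuw.
Qed.

Lemma nbE : nb = np.+2.
Proof. by case: sh sh_gt1 => [|a [|b r]]. Qed.

Lemma block_lt y : f y < np -> block y < nb.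
Proof.
by rewrite nbE /block => lt_y; repeat case: ifP => _; move: sh_gt1; lia.
Qed.

Definition members (i : nat) : seq T := [seq y <- enum T | (f y < np) && (block y == i)].

Lemma card_block i : i < nb -> size (members i) = nth 0 (blocks sh) i.
Proof.
rewrite nbE => lt_i; case: f_col => _ fc _.
rewrite -(card_uniqP (filter_uniq _ (enum_uniq T))).
have memE : [seq y <- enum T | (f y < np) && (block y == i)] =i
    [pred y | (f y < np) && (block y == i)].
  by move=> y; rewrite mem_filter mem_enum andbT.
rewrite (eq_card memE) {memE}.
have np_gt0 : 0 < np by apply: ltn_trans sh_gt1.
have np_gt1 := sh_gt1.
have fcu : #|[pred y | f y == 0]| = (#|[pred y | (f y < np) && (block y == 1)]|).+1.
  rewrite (cardD1 u) inE fu add1n; congr _.+1; apply: eq_card => y; rewrite !inE /block.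
  case: (y == u) => /=; first by rewrite andbF.
  by case: (y == w); repeat case: ifP => ?; lia.
have fcw : #|[pred y | f y == 1]| = (#|[pred y | (f y < np) && (block y == 3)]|).+1.
  rewrite (cardD1 w) inE fw add1n; congr _.+1; apply: eq_card => y; rewrite !inE /block.
  have [->|_] := eqVneq y u; first by rewrite fu !andbF.
  have [->|_] := eqVneq y w; first by rewrite fw andbF.
  by repeat case: ifP => ?; lia.
have card1p (v : T) p : f v < np -> (forall y, (block y == p) = (y == v)) ->
    #|[pred y | (f y < np) && (block y == p)]| = 1.
  move=> lt_v blockE; rewrite -(card1 v); apply: eq_card => y; rewrite !inE blockE.
  by have [->|] := eqVneq y v; rewrite ?lt_v ?andbF.
rewrite fc // in fcu; rewrite fc // in fcw.
case: i lt_i => [|[|[|[|i]]]] lt_i.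
- by rewrite (card1p u) ?fu //; [case: sh sh_gt1 => [|a [|b r]] | exact: block0E].
- by case: sh sh_gt1 fcu => [|a [|b r]] //= _ ->.
- by rewrite (card1p w) ?fw //; [case: sh sh_gt1 => [|a [|b r]] | exact: block2E].
- by case: sh sh_gt1 fcw => [|a [|b r]] //= _ ->.
have lt_i2 : i.+2 < np by [].
transitivity (nth 0 sh i.+2); last by case: sh sh_gt1 => [|a [|b r]].
rewrite -fc //; apply: eq_card => y; rewrite !inE.
apply/andP/eqP => [[_ /eqP blk]|fy].
  by rewrite -block_partE blk /block_part /= subn2.
rewrite fy lt_i2 /block fy; split=> //.
have [yu|_] := eqVneq y u; first by rewrite yu fu in fy.
have [yw|_] := eqVneq y w; first by rewrite yw fw in fy.
by rewrite addn2.
Qed.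

Lemma mem_members i y : (y \in members i) = (f y < np) && (block y == i).
Proof. by rewrite mem_filter mem_enum andbT. Qed.

Lemma members_uniq n : uniq (flatten (mkseq members n)).
Proof.
suff [//]: uniq (flatten (mkseq members n)) /\
  forall y, y \in flatten (mkseq members n) -> block y < n.
elim: n => [|n [m_uniq m_lt]]; first by split.
rewrite mkseqS flatten_rcons; split=> [|y]; last first.
  rewrite mem_cat => /orP[/m_lt/ltnW //|]; rewrite mem_members => /andP[_ /eqP->] //.
rewrite cat_uniq m_uniq filter_uniq ?enum_uniq // andbT.
apply/hasPn => y; rewrite mem_members => /andP[_ /eqP yn].
by apply/negP => /m_lt; rewrite yn ltnn.
Qed.

Definition named (z : T) : seq T := flatten (map (first_adjacent z) (mkseq members nb)).

Lemma perm_named z : perm_eq (named z) (flatten (mkseq members nb)).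
Proof.
rewrite /named; elim: (mkseq _ _) => //= B Bs IHBs.
by rewrite perm_cat //; apply/permPl/(perm_filterC (h z) B).
Qed.

Lemma mem_named z y : (y \in named z) = (f y < np).
Proof.
rewrite (perm_mem (perm_named z)); apply/flattenP/idP => [[B /mapP[i _ ->]]|lt_y].
  by rewrite mem_members => /andP[].
exists (members (block y)); last by rewrite mem_members lt_y eqxx.
by apply/mapP; exists (block y); rewrite // mem_iota block_lt.
Qed.

Lemma leq_card_cover (O : pred T) s : (forall z, O z -> has (h z) s) ->
  #|O| <= sumn [seq #|[pred z | O z & h y z]| | y <- s].
Proof.
move=> cover; apply: (@leq_trans #|[pred z | O z & has (h z) s]|).
  by apply/subset_leq_card/subsetP => z Oz; rewrite inE [O z]Oz cover.
elim: s {cover} => [|y s IHs] /=.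
  by rewrite leqn0; apply/eqP/eq_card0 => z; rewrite inE andbF.
apply: leq_trans (leq_add (leqnn _) IHs); rewrite -cardUI.
apply: leq_trans (leq_addr _ _); apply/subset_leq_card/subsetP => z; rewrite !inE.
by rewrite (h_sym y) andb_orr.
Qed.

Lemma leq_sumn_map (S : eqType) (F G : S -> nat) s :
  (forall i, i \in s -> F i <= G i) -> sumn (map F s) <= sumn (map G s).
Proof.
elim: s => //= i s IHs le_FG; rewrite leq_add ?le_FG ?mem_head //.
by apply: IHs => j j_in; rewrite le_FG // inE j_in orbT.
Qed.

Lemma exists_avoiding avoid :
  sumn [seq nth 0 avoid b * block_slack sh b | b <- iota 0 nb] < 12 - sumn sh ->
  exists2 z, f z = np & forall b y, b < nb -> y \in take (nth 0 avoid b) (members b) -> ~~ h z y.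
Proof.
move=> room; pose O : pred T := [pred z | f z == np].
pose s := flatten (mkseq (fun b => take (nth 0 avoid b) (members b)) nb).
have [/existsP[z /andP[/eqP fz /hasPn none]]|/existsPn all_adj] :=
    boolP [exists z, (z \in O) && ~~ has (h z) s].
  exists z => // b y lt_b y_in; apply: none; apply/flattenP.
  by exists (take (nth 0 avoid b) (members b)) => //; apply/mapP; exists b; rewrite // mem_iota.
have le_card : 12 - sumn sh <= #|O|.
  rewrite leq_subLR; apply: leq_trans T_ge12 _.
  rewrite -(card_coloured f_col) -(cardC [pred y | f y < np]) leq_add2l.
  apply/subset_leq_card/subsetP => y; rewrite !inE -leqNgt => le_y.
  by rewrite eqn_leq le_y andbT; case: f_col.
suff le_O : #|O| <= sumn [seq nth 0 avoid b * block_slack sh b | b <- iota 0 nb].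
  by have := leq_trans room (leq_trans le_card le_O); rewrite ltnn.
apply: leq_trans (leq_card_cover (s := s) _) _ => [z Oz|].
  by have := all_adj z; rewrite [z \in O]Oz negbK.
rewrite /s map_flatten sumn_flatten -!map_comp; apply: leq_sumn_map => b.
rewrite mem_iota /= => lt_b.
have slack_ok y : y \in take (nth 0 avoid b) (members b) ->
    #|[pred z | O z & h y z]| <= block_slack sh b.
  move/mem_take; rewrite mem_members => /andP[lt_y /eqP yb].
  apply: (@leq_trans (capacity sh f u w y)); last first.
    by rewrite /capacity /block_slack -yb !eqnE block0E block2E block_partE !inE.
  apply: leq_trans (spoils_le_capacity h_deg f_col fu fw lt_y).
  apply/subset_leq_card/subsetP => z; rewrite !inE => /andP[/eqP zO hyz].
  by rewrite /in_mem /= /spoils hyz /same_or_unused zO !eqnE eqxx orbT.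
have : size (take (nth 0 avoid b) (members b)) <= nth 0 avoid b.
  by rewrite size_take; case: ltnP.
move/(leq_mul)/(_ (leqnn (block_slack sh b)))/(leq_trans _); apply.
elim: (take _ _) slack_ok => //= y s' IHs' slack_ok; rewrite mulSn leq_add ?slack_ok ?mem_head //.
by apply: IHs' => y' y'_in; rewrite slack_ok // inE y'_in orbT.
Qed.

Lemma refuted_codes_sound shapes tries avoid : saturated shapes ->
  sumn [seq nth 0 avoid b * block_slack sh b | b <- iota 0 nb] < 12 - sumn sh ->
  ~~ all (refuted_codes shapes tries) (codes 0 (blocks sh) avoid).
Proof.
move=> sat /exists_avoiding[z fz z_avoids]; apply/allPn.
pose cd y : code := if y == z then None else Some (block y, h z y).
have cdz : cd z = None by rewrite /cd eqxx.
have cd_named y : f y < np -> cd y = Some (block y, h z y).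
  by rewrite /cd; case: eqP => // -> ; rewrite fz ltnn.
exists (map cd (named z)).
  have -> : blocks sh = map size (mkseq members nb).
    apply: (@eq_from_nth _ 0); rewrite ?size_map ?size_iota // => b lt_b.
    by rewrite (nth_map [::]) ?size_mkseq // nth_mkseq // card_block.
  apply: mem_codes => [b y|b]; rewrite size_mkseq => lt_b; rewrite nth_mkseq //.
    by rewrite mem_members => /andP[lt_y /eqP <-]; rewrite cd_named.
  rewrite -{1}(cat_take_drop (nth 0 avoid b) (members b)) count_cat.
  rewrite (_ : count _ (take _ _) = 0) ?add0n -?size_drop ?count_size //.
  by apply/eqP; rewrite -leqn0 leqNgt -has_count; apply/hasPn => y; apply: z_avoids.
have z_new : z \notin named z by rewrite mem_named fz ltnn.
have all_uniq : uniq (z :: named z).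
  by rewrite /= z_new (perm_uniq (perm_named z)) members_uniq.
have st_ok a b : a \in z :: named z -> b \in z :: named z -> a != b ->
    status_ok h a (code_status (cd a) (cd b)) b.
  rewrite !inE !mem_named; case: (eqVneq a z) => [->|_] /=; case: (eqVneq b z) => [->|_] //=.
  - by move=> _ lt_b _; rewrite cdz cd_named //=; case hzb: (h z b) => //=; rewrite hzb.
  - by move=> lt_a _ _; rewrite cdz cd_named //=; case hza: (h z a); rewrite /= h_sym hza.
  - by move=> lt_a lt_b aDb; rewrite !cd_named //=; apply: block_statusP.
have overfullF : overfull (None :: map cd (named z)) = false.
  by rewrite -cdz -map_cons; apply/negbTE/overfull_sound.
rewrite /refuted_codes overfullF /=; apply/hasPn => b _; apply/nandP.
case x_in: (has _ _); [right | by left].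
have [x [rest [permx cdx ->]]] := remove_codeP x_in.
have x_named : f x < np by rewrite -(mem_named z) (perm_mem permx) mem_head.
have nhxz : ~~ h x z.
  by move: cdx; rewrite cd_named // h_sym => -[_ ->].
have xDz : x != z by apply: contraTneq x_named => ->; rewrite fz ltnn.
have [sh' sh'_in [f' [col' f'x f'z sh'_gt1]]] := sat x z xDz nhxz.
apply/allPn; exists sh' => //; rewrite -cdx -cdz.
have permxz : perm_eq (z :: named z) [:: x, z & rest].
  rewrite -(perm_cons z) in permx; apply: perm_trans permx _.
  by rewrite (perm_catCA [:: z] [:: x] rest).
apply: (refuted_sound h_sym h_deg h_free col' f'x f'z) => //.
- by rewrite cdx cdz.
- by rewrite cdx cdz.
- by rewrite -(perm_uniq permxz).
by move=> a c; rewrite -!(perm_mem permxz); apply: st_ok.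
Qed.
End Blocks.

Lemma refuted_shapeP shapes a b r avoid tries : saturated shapes ->
  refuted_shape shapes [:: a, b & r] avoid tries ->
  saturated [seq sh <- shapes | (sh != [:: a, b & r]) && (sh != [:: b, a & r])].
Proof.
move=> sat /andP[room refuted_all].
have no_pattern u w : ~~ h u w -> ~ pattern h [:: a, b & r] u w.
  move=> nhuw [f [col fu fw _]].
  by have := refuted_codes_sound col fu fw isT nhuw tries sat room; rewrite refuted_all.
move=> x z xDz nhxz; have [sh sh_in pat] := sat x z xDz nhxz.
exists sh => //; rewrite mem_filter sh_in andbT; apply/andP; split; apply/eqP => shE.
  by apply: (no_pattern x z); rewrite -?shE.
by apply: (no_pattern z x); rewrite ?(h_sym z) //; apply: pattern_swap; rewrite -shE.
Qed.

(* Blocks as before for [5; 5], with a further block 4 for the vertex of the part of u that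
   is paired with u. *)
Definition endgame_status (b c : nat) : status :=
  match b, c with
  | 0, 2 | 2, 0 | 0, 4 | 4, 0 => Non
  | (2 | 3), (2 | 3) => Unk
  | (2 | 3), _ | _, (2 | 3) => Adj
  | _, _ => Unk
  end.

Lemma no_balanced_pattern shapes u w : saturated shapes -> ~~ h u w ->
  all (fun sh => refuted endgame_status sh 0 4 [:: 1; 1; 1; 2; 3; 3; 3; 3]) shapes ->
  ~ pattern h [:: 5; 5] u w.
Proof.
move=> sat nhuw /allP refuted_all [f [col fu fw _]].
have [_ fc fr] := col.
have uDw : u != w by apply/eqP => uw; move: fw; rewrite -uw fu.
pose class (i : nat) (s : seq T) := [seq y <- enum T | (f y == i) && (y \notin s)].
have mem_class i s y : (y \in class i s) = (f y == i) && (y \notin s).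
  by rewrite mem_filter mem_enum andbT.
have class_uniq i s : uniq (class i s) by rewrite filter_uniq ?enum_uniq.
have size_class i s : i < 2 -> uniq s -> (forall y, y \in s -> f y = i) ->
    size (class i s) = 5 - size s.
  move=> lt_i s_uniq sP; rewrite -(card_uniqP (class_uniq i s)) -(card_uniqP s_uniq).
  have -> : 5 = #|[pred y | f y == i]| by rewrite fc //; case: i lt_i {sP} => [|[|]].
  rewrite -(cardID (mem s) [pred y | f y == i]).
  have -> : #|[predI [pred y | f y == i] & mem s]| = #|s|.
    by apply: eq_card => y; rewrite !inE; apply/andP/idP => [[]//|y_in]; rewrite sP.
  by rewrite addKn; apply: eq_card => y; rewrite !inE mem_filter mem_enum andbT andbC.
have u_adj x : x != u -> f x = 0 -> h u x.
  move=> xDu fx; apply: contraT => nhux.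
  have uDx : u != x by rewrite eq_sym.
  have [sh sh_in [f' [col' f'u f'x sh_gt1]]] := sat u x uDx nhux.
  pose cd y := if y == u then 0 else if y == x then 4 else if y == w then 2
               else if f y == 0 then 1 else 3.
  have wDu : w == u = false by rewrite eq_sym; apply/negbTE.
  have wDx : w == x = false by apply: contraFF wDu => /eqP wx; move: fw; rewrite wx fx.
  have cdu : cd u = 0 by rewrite /cd eqxx.
  have cdx : cd x = 4 by rewrite /cd (negPf xDu) eqxx.
  have cdw : cd w = 2 by rewrite /cd wDu wDx eqxx.
  pose rest := class 0 [:: u; x] ++ w :: class 1 [:: w].
  have codesE : map cd rest = [:: 1; 1; 1; 2; 3; 3; 3; 3].
    have const i s c : (forall y, y \in class i s -> cd y = c) ->
        map cd (class i s) = nseq (size (class i s)) c.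
      move=> cdE; rewrite -(size_map cd); apply/all_pred1P/allP => _ /mapP[y /cdE-> ->] /=.
      exact: eqxx.
    have code1 y : y \in class 0 [:: u; x] -> cd y = 1.
      rewrite mem_class !inE => /andP[/eqP fy /norP[/negPf yu /negPf yx]].
      rewrite /cd yu yx fy; have [yw|//] := eqVneq y w.
      by move: fy; rewrite yw fw.
    have code3 y : y \in class 1 [:: w] -> cd y = 3.
      rewrite mem_class inE => /andP[/eqP fy /negPf yw]; rewrite /cd yw fy.
      have [yu|_] := eqVneq y u; first by move: fy; rewrite yu fu.
      by have [yx|_] := eqVneq y x; first by move: fy; rewrite yx fx.
    rewrite map_cat /= cdw (const _ _ _ code1) (const _ _ _ code3).
    rewrite !size_class //= ?inE ?uDx // => y.
      by rewrite inE => /eqP->.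
    by rewrite !inE => /orP[] /eqP->.
  have mem_rest y : y \in rest -> f y < 2.
    rewrite mem_cat inE !mem_class => /or3P[/andP[/eqP->]|/eqP->|/andP[/eqP->]] //.
    by rewrite fw.
  have all_uniq : uniq [:: u, x & rest].
    have u_new : u \notin rest.
      by rewrite mem_cat inE !mem_class fu !inE !eqxx (negPf uDw).
    have x_new : x \notin rest.
      by rewrite mem_cat inE !mem_class fx !inE !eqxx orbT (eq_sym x w) wDx /=.
    rewrite !cons_uniq inE negb_or uDx u_new x_new cat_uniq cons_uniq !class_uniq /= andbT.
    rewrite negb_or !mem_class fw !inE !eqxx /= andbT.
    by apply/hasPn => y; rewrite !mem_class => /andP[/eqP-> _].
  have := refuted_sound h_sym h_deg h_free col' f'u f'x
     (st := endgame_status) (cd := cd) _ _ sh_gt1 all_uniq.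
  rewrite codesE cdu cdx refuted_all //; apply=> // y y' y_in y'_in yDy'.
  have f_lt2 v : v \in [:: u, x & rest] -> f v < 2.
    by rewrite !inE => /or3P[/eqP->|/eqP->|/mem_rest]; rewrite ?fu ?fx.
  have lt_y := f_lt2 y y_in; have lt_y' := f_lt2 y' y'_in.
  have cdE v : cd v = if f v == 0 then (if v == u then 0 else if v == x then 4 else 1)
                      else if v == w then 2 else 3.
    rewrite /cd; have [->|_] := eqVneq v u; first by rewrite fu.
    have [->|_] := eqVneq v x; first by rewrite fx.
    have [->|_] := eqVneq v w; first by rewrite fw.
    by [].
  have adj : f y != f y' -> ~~ ((y == u) && (y' == w)) -> ~~ ((y == w) && (y' == u)) -> h y y'.
    by move=> neq n1 n2; have /or3P[//||] := fr y y' lt_y lt_y' neq; apply/contraLR.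
  have zero_or_one v : f v < 2 -> f v = 0 \/ f v = 1 by case: (f v) => [|[|]]; auto.
  have mixed a b : f a = 0 -> f b = 1 -> status_ok h a (endgame_status (cd a) (cd b)) b /\
      status_ok h b (endgame_status (cd b) (cd a)) a.
    move=> fa fb; rewrite !cdE fa fb /=.
    have [bu|_] := eqVneq b u; first by move: fb; rewrite bu fu.
    have [aw|aDw] := eqVneq a w; first by move: fa; rewrite aw fw.
    have hab : ~~ ((a == u) && (b == w)) -> h a b.
      move=> n; have /or3P[//|/= uw|/= /andP[aw _]] : link h u w a b.
      + by apply: fr; rewrite ?fa ?fb.
      + by rewrite uw in n.
      + by rewrite aw in aDw.
    case: (eqVneq a u) hab => [->|_]; case: (eqVneq b w) => [->|_] /= hab.
    + by rewrite (h_sym w) nhuw.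
    + by rewrite (h_sym b) hab.
    + by case: (a == x); rewrite /= (h_sym w) hab.
    by case: (a == x); rewrite /= (h_sym b) hab.
  case: (zero_or_one _ lt_y) => fy; case: (zero_or_one _ lt_y') => fy'.
  - rewrite !cdE fy fy' /=; move: yDy'.
    have [->|_] := eqVneq y u; have [->|_] := eqVneq y' u; rewrite ?eqxx //=.
    + by have [->|] := eqVneq y' x.
    + by have [->|] := eqVneq y x; rewrite //= h_sym.
    by case: (y == x); case: (y' == x).
  - by case: (mixed _ _ fy fy').
  - by case: (mixed _ _ fy' fy).
  rewrite !cdE fy fy' /=.
  by case: (y == w); case: (y' == w).
have deg_u : #|[pred y | (f y < 2) && (y \notin [:: u; w])]| <= 7.
  apply: leq_trans (h_deg u); apply/subset_leq_card/subsetP => y; rewrite !inE negb_or.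
  case/and3P=> lt_y yDu yDw; case fy: (f y) lt_y => [|[|]] // _; first exact: u_adj.
  have /or3P[//|/= /andP[_ yw]|/= /andP[uw _]] : link h u w u y.
  - by apply: fr; rewrite ?fu ?fy.
  - by rewrite yw in yDw.
  - by rewrite uw in uDw.
have card10 : #|[pred y | f y < 2]| = 10 := card_coloured col.
have le2 : #|[predI [pred y | f y < 2] & mem [:: u; w]]| <= 2.
  apply: leq_trans (card_size [:: u; w]); apply/subset_leq_card/subsetP => y.
  by rewrite !inE => /andP[].
have le7 : #|[predD [pred y | f y < 2] & mem [:: u; w]]| <= 7.
  apply: leq_trans deg_u; apply/subset_leq_card/subsetP => y; rewrite !inE.
  by case/andP=> -> ->.
by have := leq_add le2 le7; rewrite cardID card10.
Qed.
End Elimination.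

Definition shapes : seq (seq nat) :=
  [:: [:: 3; 7]; [:: 7; 3]; [:: 1; 1; 7]; [:: 5; 5]; [:: 1; 3; 5]; [:: 1; 5; 3];
      [:: 3; 1; 5]; [:: 5; 1; 3]; [:: 1; 1; 1; 5]; [:: 1; 5; 1; 1]; [:: 5; 1; 1; 1];
      [:: 3; 3; 3]; [:: 1; 1; 3; 3]; [:: 1; 3; 1; 3]; [:: 3; 1; 1; 3]; [:: 3; 3; 1; 1];
      [:: 1; 1; 1; 1; 3]; [:: 1; 3; 1; 1; 1]; [:: 3; 1; 1; 1; 1]; [:: 1; 1; 1; 1; 1; 1]].

Definition swap_head (sh : seq nat) : seq nat := if sh is a :: b :: r then b :: a :: r else sh.

Definition drop_shape (sh : seq nat) (shs : seq (seq nat)) : seq (seq nat) :=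
  [seq s <- shs | (s != sh) && (s != swap_head sh)].

Fixpoint eliminate (shs : seq (seq nat)) (plan : seq (seq nat * seq nat * seq nat)) :
    option (seq (seq nat)) :=
  if plan is (sh, avoid, tries) :: plan' then
    if (1 < size sh) && refuted_shape shs sh avoid tries
    then eliminate (drop_shape sh shs) plan' else None
  else Some shs.

Lemma eliminate_sound (T : finType) (h : rel T) shs plan shs' : symmetric h ->
  neighbours_le h 7 -> family_free h -> 12 <= #|T| ->
  saturated h shs -> eliminate shs plan = Some shs' -> saturated h shs'.
Proof.
move=> h_sym h_deg h_free T_ge12.
elim: plan shs => [|[[sh avoid] tries] plan IHplan] shs sat /=; first by case=> <-.
case: sh => [|a [|b r]] //; case: ifP => // /(refuted_shapeP h_sym h_deg h_free T_ge12 sat).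
exact: IHplan.
Qed.

(* Each step gives a shape, the number of vertices avoided in each block, and the blocks in
   which to look for x; the plan was found by computer. *)
Lemma eliminate_shapes : eliminate shapes
  [:: ([:: 1; 1; 3; 3], [:: 1; 0; 1; 0; 0; 0], [:: 0]);
      ([:: 1; 3; 1; 3], [:: 1; 0; 0; 1; 0; 0], [:: 5; 0; 2; 3]);
      ([:: 1; 3; 1; 1; 1], [:: 1; 0; 0; 0; 1; 1; 0], [:: 4]);
      ([:: 5; 1; 1; 1], [:: 0; 0; 1; 0; 0; 0], [:: 4; 2]);
      ([:: 3; 7], [:: 1; 0; 0; 0], [:: 0; 1]);
      ([:: 1; 5; 3], [:: 0; 0; 0; 0; 2], [:: 4; 0]);
      ([:: 3; 3; 1; 1], [:: 1; 0; 0; 0; 0; 0], [:: 0; 2; 4]);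
      ([:: 1; 1; 1; 1; 3], [:: 1; 0; 0; 0; 1; 1; 0], [:: 0; 6]);
      ([:: 1; 1; 1; 1; 1; 1], [:: 1; 0; 0; 0; 1; 0; 0; 0], [:: 0; 4; 7; 6]);
      ([:: 3; 3; 3], [:: 0; 1; 0; 1; 0], [:: 2; 4; 0; 1; 3]);
      ([:: 1; 1; 1; 5], [:: 1; 0; 1; 0; 0; 0], [:: 0; 4]);
      ([:: 1; 3; 5], [:: 0; 0; 0; 1; 0], [:: 0; 4])]
  = Some [:: [:: 1; 1; 7]; [:: 5; 5]].
Proof. by vm_compute. Qed.

Lemma eliminate_twins : eliminate [:: [:: 1; 1; 7]] [:: ([:: 1; 1; 7], [::], [:: 4; 0])] = Some [::].
Proof. by vm_compute. Qed.

Lemma not_saturated (T : finType) (h : rel T) : symmetric h -> irreflexive h ->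
  neighbours_le h 7 -> family_free h -> 12 <= #|T| -> ~ saturated h shapes.
Proof.
move=> h_sym h_irr h_deg h_free T_ge12 sat.
have sat2 := eliminate_sound h_sym h_deg h_free T_ge12 sat eliminate_shapes.
have sat1 : saturated h [:: [:: 1; 1; 7]].
  move=> x z xDz nhxz; have [sh] := sat2 x z xDz nhxz.
  rewrite !inE => /orP[] /eqP-> pat; first by exists [:: 1; 1; 7]; rewrite ?inE.
  by case: (no_balanced_pattern h_sym h_deg h_free sat2 nhxz _ pat); vm_compute.
have sat0 := eliminate_sound h_sym h_deg h_free T_ge12 sat1 eliminate_twins.
have /card_gt0P[x _] : 0 < #|T| by apply: leq_trans T_ge12.
have [z] : exists z, z \notin [pred z | (z == x) || h x z].
  apply/existsP; rewrite -negb_forall; apply/negP => /forallP all_in.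
  have : #|T| <= 8; last by rewrite leqNgt (leq_trans _ T_ge12).
  rewrite -(eq_card (A := [pred z | (z == x) || h x z])) => [|z]; last first.
    by rewrite [LHS]all_in.
  by rewrite (cardD1 x) inE eqxx add1n ltnS; apply: leq_trans (h_deg x); apply/subset_leq_card/subsetP => z; rewrite !inE; case: eqP.
rewrite !inE negb_or eq_sym => /andP[xDz nhxz].
by have [] := sat0 x z xDz nhxz.
Qed.

(** * Tutte's theorem *)

Section Matchings.
Variable T : finType.
Implicit Types (g : rel T) (W : {set T}) (m : T -> T).

Definition matching g W m : Prop :=
  forall x, x \in W -> [/\ m x \in W, m (m x) = x & g x (m x)].

Definition matchable g W : bool :=
  [exists m : {ffun T -> T}, [forall x in W, [&& m x \in W, m (m x) == x & g x (m x)]]].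

Lemma matchableP g W : reflect (exists m, matching g W m) (matchable g W).
Proof.
apply: (iffP existsP) => [[m /forallP m_ok]|[m m_ok]].
  by exists m => x xW; have /implyP/(_ xW)/and3P[? /eqP ? ?] := m_ok x; split.
exists [ffun x => m x]; apply/forallP => x; apply/implyP => /m_ok[mW mm gm].
by rewrite !ffunE mW mm gm eqxx.
Qed.

Lemma matching_total g W m : matching g W m ->
  exists m', matching g W m' /\ involutive m'.
Proof.
move=> m_ok; exists (fun x => if x \in W then m x else x); split=> x.
  by move=> xW; have [mW mm gm] := m_ok x xW; rewrite xW mW.
by case xW: (x \in W); rewrite ?xW //; have [-> -> _] := m_ok x xW.
Qed.

Lemma link_sym g a c : symmetric g -> symmetric (link g a c).
Proof.
move=> g_sym x y; rewrite /link /= g_sym; congr (_ || _).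
by rewrite orbC (andbC (x == a)) (andbC (x == c)).
Qed.

Lemma link_irr g a c : irreflexive g -> a != c -> irreflexive (link g a c).
Proof.
move=> g_irr aDc x; rewrite /link /= g_irr /=.
by have [->|_] := eqVneq x a; rewrite ?(negPf aDc) ?andbF // andbF.
Qed.

Section Swap.
Variables (g : rel T) (W : {set T}) (a b c d : T).
Hypotheses (g_sym : symmetric g) (g_irr : irreflexive g).
Hypotheses (gab : g a b) (gbc : g b c) (bW : b \in W) (dW : d \in W).
Hypotheses (aDc : a != c) (bDd : b != d) (nbd : ~~ g b d).

Variables m1 m2 : T -> T.
Hypotheses (m1_ok : matching (link g a c) W m1) (m2_ok : matching (link g b d) W m2).
Hypotheses (m1K : involutive m1) (m2K : involutive m2).
Hypotheses (m1a : m1 a = c) (m2b : m2 b = d).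

Let w i := iter i (m2 \o m1) d.

Lemma walkS i : w i.+1 = m2 (m1 (w i)). Proof. by []. Qed.

Lemma walkW i : w i \in W.
Proof.
elim: i => // i wW; rewrite walkS.
by have [/m2_ok[]] := m1_ok wW.
Qed.

Lemma m1_neq x : x \in W -> m1 x != x.
Proof.
by move=> /m1_ok[_ _ gm]; apply: contraTneq gm => ->; rewrite link_irr.
Qed.

Lemma m2_neq x : x \in W -> m2 x != x.
Proof.
by move=> /m2_ok[_ _ gm]; apply: contraTneq gm => ->; rewrite link_irr.
Qed.

Lemma walk_alternates p q : w p != m1 (w q).
Proof.
suff step k i : w (i + k) != m1 (w i).
  have [le_qp|/ltnW le_pq] := leqP q p; first by rewrite -(subnKC le_qp).
  by apply: contraNneq (step (q - p) p) => ->; rewrite subnKC // m1K.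
have [n] := ubnP k; elim: n k i => // n IHn [|[|k]] i lt_k.
- by rewrite addn0 eq_sym m1_neq ?walkW.
- by rewrite addn1 walkS m2_neq //; have [] := m1_ok (walkW i).
apply/eqP; rewrite addnS walkS => /(congr1 m2); rewrite m2K -walkS => /(congr1 m1).
by rewrite m1K addnS -addSn => /eqP; apply/negP/IHn/ltnW.
Qed.

Lemma walk_returns : exists i, m1 (w i) = b.
Proof.
have inj : injective (m2 \o m1) by apply: inj_comp (inv_inj m2K) (inv_inj m1K).
have := iter_order inj d; case: (order _ d) (order_gt0 (m2 \o m1) d) => // i _ /= wd.
by exists i; apply: (inv_inj m2K); rewrite m2b.
Qed.

Definition visited n : pred T := [pred v | has (fun j => (v == w j) || (v == m1 (w j))) (iota 0 n)].

Lemma visitedP n v : reflect (exists2 j, j < n & v = w j \/ v = m1 (w j)) (visited n v).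
Proof.
apply: (iffP hasP) => [[j]|[j lt_j vE]].
  by rewrite mem_iota => /= lt_j /orP[]/eqP->; exists j; auto.
by exists j; rewrite ?mem_iota //; case: vE => ->; rewrite eqxx ?orbT.
Qed.

Lemma visited_m1 n v : visited n (m1 v) = visited n v.
Proof.
have half u : visited n u -> visited n (m1 u).
  by case/visitedP=> j lt_j [] ->; apply/visitedP; exists j; rewrite ?m1K; auto.
by apply/idP/idP => [/half|/half //]; rewrite m1K.
Qed.

Lemma visitedW n v : visited n v -> v \in W.
Proof.
by case/visitedP=> j _ [] ->; [exact: walkW | have [] := m1_ok (walkW j)].
Qed.

(* Follow the alternating path from [d] until it reaches [b], [a] or [c]; the two matchings
   are exchanged along it, closing it with an edge from [b] to [a] or [c] in the latter case. *)
Lemma swap_matchable : matchable g W.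
Proof.
have [i0 m1i0] := walk_returns.
have ex_stop : exists i, (m1 (w i) == b) || (w i \in [:: a; c]).
  by exists i0; rewrite m1i0 eqxx.
have [i /orP stop min_i] := ex_minnP ex_stop.
have aDb : a != b by apply: contraTneq gab => ->; rewrite g_irr.
have cDb : c != b by apply: contraTneq gbc => ->; rewrite g_irr.
have aDd : a != d by apply: contraNneq nbd => <-; rewrite g_sym.
have cDd : c != d by apply: contraNneq nbd => <-.
have before j : j < i -> m1 (w j) != b /\ w j \notin [:: a; c].
  move=> lt_j; apply/andP; rewrite -negb_or; apply: contraL lt_j => /min_i.
  by rewrite -leqNgt.
have m1c : m1 c = a by rewrite -m1a m1K.
have m1_g v : v \in W -> v \notin [:: a; c] -> g v (m1 v).
  case/m1_ok=> _ _ /or3P[//|/andP[/eqP-> _]|/andP[/eqP-> _]]; rewrite !inE eqxx ?orbT //.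
have m2_g v : v \in W -> v != b -> v != d -> g v (m2 v).
  by case/m2_ok=> _ _ /or3P[//|/andP[-> _]|/andP[-> _]].
have visited_g n v : (forall j, j < n -> w j \notin [:: a; c]) -> visited n v -> g v (m1 v).
  move=> out vv; apply: m1_g; first exact: visitedW vv.
  case/visitedP: vv => j /out w_out [] -> //; apply: contra w_out; rewrite !inE.
  by case/orP=> /eqP m1w; rewrite -(m1K (w j)) m1w ?m1a ?m1c eqxx ?orbT.
have visited_m2 n v : v != b -> visited n (m2 v) -> visited n v \/ v = w n.
  move=> vDb /visitedP[[|j] lt_j [m2v|m2v]].
  - by case/eqP: vDb; apply: (inv_inj m2K); rewrite m2b.
  - have -> : v = w 1 by rewrite walkS -m2v m2K.
    by case: n lt_j => [|[|n]] // _; [right | left; apply/visitedP; exists 1; auto].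
  - left; apply/visitedP; exists j; rewrite ?(ltnW lt_j) //; right.
    by rewrite -(m2K v) m2v walkS m2K.
  have -> : v = w j.+2 by rewrite walkS -m2v m2K.
  by move: lt_j; rewrite leq_eqVlt => /orP[/eqP<-|lt_j]; [right | left; apply/visitedP; exists j.+2; auto].
apply/matchableP; case w_ac: (w i \in [:: a; c]); last first.
  case: stop => [/eqP m1w|]; last by rewrite w_ac.
  have out j : j < i.+1 -> w j \notin [:: a; c].
    by rewrite ltnS leq_eqVlt => /orP[/eqP->|/before[]//]; rewrite w_ac.
  have vb : visited i.+1 b by apply/visitedP; exists i; rewrite -?m1w; auto.
  have vd : visited i.+1 d by apply/visitedP; exists 0; auto.
  exists (fun v => if visited i.+1 v then m1 v else m2 v) => v vW.
  case vv: (visited _ v).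
    rewrite visited_m1 vv m1K; split=> //; last exact: visited_g vv.
    by have [] := m1_ok vW.
  have vDb : v != b by apply: contraFneq vv => ->.
  have vDd : v != d by apply: contraFneq vv => ->.
  case vm: (visited _ (m2 v)); last by rewrite m2K m2_g //; split=> //; have [] := m2_ok vW.
  have [|vE] := visited_m2 _ _ vDb vm; first by rewrite vv.
  by move: vDd; rewrite vE walkS m1w m2b eqxx.
have i_gt0 : 0 < i.
  rewrite lt0n; apply: contraTneq w_ac => ->.
  by rewrite !inE negb_or (eq_sym _ a) aDd (eq_sym _ c) cDd.
have wDb : w i != b by move: w_ac; rewrite !inE => /orP[] /eqP->.
have gwb : g (w i) b by move: w_ac; rewrite !inE => /orP[] /eqP->; rewrite // g_sym.
have vw : visited i (w i) = false.
  apply/visitedP => -[j lt_j [wE|wE]]; last by have := walk_alternates i j; rewrite wE eqxx.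
  by have [_] := before j lt_j; rewrite -wE w_ac.
have vb : visited i b = false.
  apply/visitedP => -[[|j] lt_j [bE|bE]].
  - by case/eqP: bDd.
  - by have [] := before 0 lt_j; rewrite -bE eqxx.
  - have := walk_alternates 0 j; rewrite -[m1 (w j)]m2K -walkS -bE m2b eqxx //.
  by have [] := before _ lt_j; rewrite -bE eqxx.
have vd : visited i d by apply/visitedP; exists 0; auto.
exists (fun v => if visited i v then m1 v else if v == w i then b
                 else if v == b then w i else m2 v) => v vW.
case vv: (visited _ v).
  rewrite visited_m1 vv m1K; split=> //; first by have [] := m1_ok vW.
  by apply: visited_g vv => j /before[].
have [->|vDw] := eqVneq v (w i); first by rewrite vb eq_sym (negPf wDb) eqxx; split.
have [->|vDb] := eqVneq v b; first by rewrite vw eqxx; split; rewrite ?walkW // g_sym.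
have vDd : v != d by apply: contraFneq vv => ->.
case vm: (visited _ (m2 v)).
  have [|vE] := visited_m2 _ _ vDb vm; first by rewrite vv.
  by rewrite vE eqxx in vDw.
have -> : (m2 v == w i) = false.
  apply: contraFF vv => /eqP m2v; apply/visitedP; exists i.-1; first by rewrite ltn_predL.
  by right; rewrite -(m2K v) m2v -{1}(prednK i_gt0) walkS m2K.
have -> : (m2 v == b) = false by apply/eqP => m2v; case/eqP: vDd; rewrite -(m2K v) m2v m2b.
by rewrite m2K m2_g //; split=> //; have [] := m2_ok vW.
Qed.

End Swap.

Lemma matchable_swap g W a b c d : symmetric g -> irreflexive g ->
  b \in W -> d \in W -> a != c -> b != d -> g a b -> g b c -> ~~ g b d ->
  matchable (link g a c) W -> matchable (link g b d) W -> matchable g W.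
Proof.
move=> g_sym g_irr bW dW aDc bDd gab gbc nbd.
have plain x y m : matching (link g x y) W m -> m x != y -> m y != x -> matching g W m.
  move=> m_ok mx my v vW; have [mW mm /or3P[//|/andP[/eqP vx /eqP my']|/andP[/eqP vy /eqP mx']]] := m_ok v vW.
    by case/eqP: mx; rewrite -vx.
  by case/eqP: my; rewrite -vy.
case/matchableP=> m1' /matching_total[m1 [m1_ok m1K]].
case/matchableP=> m2' /matching_total[m2 [m2_ok m2K]].
have [m1a|m1a] := eqVneq (m1 a) c; last first.
  apply/matchableP; exists m1; apply: (plain a c) => //.
  by apply: contra m1a => /eqP <-; rewrite m1K.
have [m2b|m2b] := eqVneq (m2 b) d; last first.
  apply/matchableP; exists m2; apply: (plain b d) => //.
  by apply: contra m2b => /eqP <-; rewrite m2K.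
by apply: (swap_matchable g_sym g_irr gab gbc _ _ _ _ _ m1_ok m2_ok m1K m2K m1a m2b).
Qed.

Lemma matchable0 g : matchable g set0.
Proof. by apply/matchableP; exists id => x; rewrite inE. Qed.

Lemma matchable_add g W x y : symmetric g -> x != y -> x \notin W -> y \notin W -> g x y ->
  matchable g W -> matchable g (x |: (y |: W)).
Proof.
move=> g_sym xDy xW yW gxy /matchableP[m m_ok]; apply/matchableP.
exists (fun v => if v == x then y else if v == y then x else m v) => v; rewrite !inE.
have [->|vDx] := eqVneq v x; first by rewrite (eq_sym y x) (negPf xDy) !eqxx !orbT.
have [->|vDy] /= := eqVneq v y; first by rewrite !eqxx g_sym.
case/m_ok=> mW mm gm; rewrite mW mm gm !orbT.
have -> : (m v == x) = false by apply: contraNF xW => /eqP<-.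
by have -> : (m v == y) = false by apply: contraNF yW => /eqP<-.
Qed.

Definition clique g (s : seq T) : Prop := {in s &, forall x y, x != y -> g x y}.

Lemma matchable_cliques g ps us : symmetric g ->
  uniq (flatten ps ++ us) -> (forall p, p \in ps -> clique g p) ->
  (forall x y, x \in us -> y \in flatten ps ++ us -> x != y -> g x y) ->
  count (fun p => odd (size p)) ps <= size us -> ~~ odd (size (flatten ps ++ us)) ->
  matchable g [set x in flatten ps ++ us].
Proof.
move=> g_sym.
have add_clique s W : ~~ odd (size s) -> uniq s -> clique g s ->
    (forall x, x \in s -> x \notin W) -> matchable g W -> matchable g ([set x in s] :|: W).
  have [n] := ubnP (size s); elim: n s => // n IHn [|x [|y s]] //= lt_s even_s s_uniq s_cl s_W gW.
    by rewrite (_ : _ :|: W = W) //; apply/setP => v; rewrite !inE.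
  have -> : [set v in [:: x, y & s]] :|: W = x |: (y |: ([set v in s] :|: W)).
    by apply/setP => v; rewrite !inE !orbA.
  move: s_uniq; rewrite inE negb_or => /and3P[/andP[xDy x_s] y_s s_uniq].
  have new v : v \in [:: x; y] -> v \notin s -> v \notin [set v in s] :|: W.
    move=> v_in v_s; rewrite !inE negb_or v_s; apply: s_W.
    by move: v_in; rewrite !inE => /orP[]->; rewrite ?orbT.
  apply: matchable_add; rewrite ?new ?inE ?eqxx ?orbT //; first by apply: s_cl; rewrite ?inE ?eqxx ?orbT.
  apply: IHn => //; first by apply: ltnW; rewrite ltnS in lt_s.
  - by move: even_s; rewrite negbK.
  - by move=> v v' v_in v'_in; apply: s_cl; rewrite !inE ?v_in ?v'_in !orbT.
  by move=> v v_in; apply: s_W; rewrite !inE v_in !orbT.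
elim: ps us => [|p ps IHps] us all_uniq ps_cl us_univ le_us even_all.
  rewrite -[[set x in _]]setU0; by apply: add_clique (matchable0 g) => // x; rewrite inE.
have p_uniq : uniq p by move: all_uniq; rewrite cat_uniq /= cat_uniq => /and3P[/and3P[]].
have p_cl : clique g p by apply: ps_cl; rewrite mem_head.
have ps_cl' q : q \in ps -> clique g q by move=> q_in; apply: ps_cl; rewrite inE q_in orbT.
have p_new us' x : {subset us' <= us} -> x \in p -> x \notin [set v in flatten ps ++ us'].
  move=> us'_us x_p; rewrite inE; apply/negP => x_in.
  move: all_uniq; rewrite /= -catA cat_uniq => /and3P[_ /hasPn/(_ x) + _].
  rewrite x_p mem_cat; move: x_in; rewrite mem_cat => /orP[->|/us'_us->]; rewrite ?orbT;
    by move/(_ isT).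
have [odd_p|even_p] := boolP (odd (size p)); last first.
  rewrite (_ : [set x in _] = [set x in p] :|: [set x in flatten ps ++ us]); last first.
    by apply/setP => v; rewrite !inE /= -catA mem_cat.
  apply: add_clique => //; first by move=> x; apply: p_new.
  apply: IHps => //.
  - by move: all_uniq; rewrite /= -catA cat_uniq => /and3P[].
  - by move=> x y x_in y_in; apply: us_univ; rewrite //= -catA mem_cat y_in orbT.
  - by move: le_us; rewrite /= (negPf even_p).
  by move: even_all; rewrite /= -catA size_cat oddD (negPf even_p).
case: us all_uniq us_univ le_us even_all p_new => [|y us] all_uniq us_univ le_us even_all p_new.
  by move: le_us; rewrite /= odd_p.
case: p odd_p p_uniq p_cl ps_cl p_new all_uniq us_univ le_us even_all => [//|x p] odd_p p_uniq p_cl _ p_new all_uniq us_univ le_us even_all.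
have memE : [set v in flatten ((x :: p) :: ps) ++ y :: us] =
    [set v in p] :|: (x |: (y |: [set v in flatten ps ++ us])).
  apply/setP => v; rewrite !inE /= !mem_cat !inE.
  by case: (v == x); case: (v == y); case: (v \in p); rewrite ?orbT.
have us_sub : {subset us <= y :: us} by move=> v v_in; rewrite inE v_in orbT.
have : uniq [:: y, x & p ++ (flatten ps ++ us)].
  by move: all_uniq; rewrite -[y :: us]cat1s uniq_catCA /= -catA.
rewrite !cons_uniq inE negb_or !mem_cat !negb_or cat_uniq.
case/and3P=> /and3P[yDx y_p y_rest] /andP[x_p x_rest] /and3P[p_uniq' _ rest_uniq].
rewrite memE; apply: add_clique.
- exact: odd_p.
- exact: p_uniq'.
- by move=> v v' v_in v'_in; apply: p_cl; rewrite inE ?v_in ?v'_in orbT.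
- move=> v v_in; rewrite !inE !negb_or.
  have := p_new us v us_sub; rewrite !inE v_in orbT => /(_ isT) ->.
  by rewrite andbT; apply/andP; split; [apply: contraNneq x_p | apply: contraNneq y_p] => <-.
apply: matchable_add => //.
- by rewrite eq_sym.
- by apply: p_new us_sub _; rewrite mem_head.
- by rewrite inE mem_cat negb_or.
- by rewrite g_sym; apply: us_univ; rewrite ?mem_head // mem_cat /= mem_head.
apply: IHps => //.
- move=> v v' v_in v'_in; apply: us_univ; rewrite ?inE ?v_in ?orbT //.
  by move: v'_in; rewrite !mem_cat !inE => /orP[]->; rewrite !orbT.
- by move: le_us; rewrite /= (odd_p : ~~ odd (size p)) add1n ltnS.
by move: even_all odd_p; rewrite /= !size_cat /= !oddD /=; do 3!case: (odd _).
Qed.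

Definition nonadj g : rel T := [rel x y | ~~ g x y].

Definition gap (ps : seq (seq T)) : nat := sumn [seq (uphalf (size p)).*2 | p <- ps].

Lemma gapE (ps : seq (seq T)) : gap ps = size (flatten ps) + count (fun p => odd (size p)) ps.
Proof.
rewrite /gap; elim: ps => //= p ps ->; rewrite size_cat uphalf_half doubleD.
rewrite -{3}(odd_double_half (size p)); lia.
Qed.

Lemma maximal_obstruction g W : symmetric g -> irreflexive g -> ~~ odd #|W| -> ~~ matchable g W ->
  (forall a c, a \in W -> c \in W -> a != c -> ~~ g a c -> matchable (link g a c) W) ->
  exists ps, [/\ multipartite (nonadj g) ps, {subset flatten ps <= W} & #|W| < gap ps].
Proof.
move=> g_sym g_irr even_W unmatched maximal.
pose U := [set x in W | [forall y in W, (x != y) ==> g x y]].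
pose eqg := [rel x y | (x == y) || g x y].
have eqg_equiv : {in W :\: U & &, equivalence_rel eqg}.
  have trans x y z : x \in W :\: U -> y \in W :\: U -> z \in W :\: U ->
      eqg x y -> eqg y z -> eqg x z.
    move=> /setDP[xW _] /setDP[yW yU] /setDP[zW _] /= /predU1P[->//|gxy] /predU1P[<-|gyz].
      by rewrite gxy orbT.
    have [//|xDz /=] := eqVneq x z; apply: contraNT unmatched => ngxz.
    have [d dW /andP[yDd ngyd]] : exists2 d, d \in W & (y != d) && ~~ g y d.
      move: yU; rewrite inE yW /= negb_forall => /existsP[d]; rewrite !negb_imply.
      by case/and3P=> dW yDd ngyd; exists d; rewrite ?yDd.
    by apply: (@matchable_swap g W x y z d) => //; apply: maximal.
  have sym x y : eqg x y = eqg y x by rewrite /= eq_sym g_sym.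
  move=> x y z xD yD zD; split=> [|xy]; first by rewrite /= eqxx.
  by apply/idP/idP; apply: trans; rewrite // sym.
pose P := equivalence_partition eqg (W :\: U).
have P_part : partition P (W :\: U) by apply: equivalence_partitionP.
pose ps := [seq enum B | B : {set T} <- enum P].
have mem_ps x : x \in flatten ps -> x \in W :\: U.
  case/flattenP=> _ /mapP[B + ->]; rewrite !mem_enum => BP xB.
  by rewrite -(cover_partition P_part); apply/bigcupP; exists B.
have size_ps : size (flatten ps) = #|W :\: U|.
  rewrite size_flatten /shape -map_comp (card_partition P_part) sumnE big_map big_enum /=.
  by apply: eq_bigr => B _; rewrite -cardE.
have ps_uniq : uniq (flatten ps).
  apply: (leq_size_uniq (enum_uniq (W :\: U))); last by rewrite size_ps cardE.
  move=> x; rewrite mem_enum -(cover_partition P_part) => /bigcupP[B BP xB].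
  by apply/flattenP; exists (enum B); rewrite ?mem_enum //; apply: map_f; rewrite mem_enum.
have block_eqg B x y : B \in P -> x \in B -> y \in W :\: U -> (y \in B) = eqg x y.
  move=> BP xB yD; have /and3P[/eqP coverP triv _] := P_part.
  rewrite -(def_pblock triv BP xB) pblock_equivalence_partition // -coverP.
  by apply/bigcupP; exists B.
have block_sub B x : B \in P -> x \in B -> x \in W :\: U.
  by move=> BP xB; rewrite -(cover_partition P_part); apply/bigcupP; exists B.
exists ps; split.
- rewrite /multipartite ps_uniq pairwise_map.
  have := enum_uniq P; rewrite uniq_pairwise; apply: (@sub_in_pairwise _ [in P]); last first.
    by apply/allP => B; rewrite mem_enum.
  move=> A B AP BP /= ADB; apply/allP => x; rewrite mem_enum => xA.
  apply/allP => y; rewrite mem_enum => yB; apply: contraNN ADB => gxy.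
  have yA : y \in A by rewrite (block_eqg A x y AP xA (block_sub B y BP yB)) /= gxy orbT.
  have /and3P[_ triv _] := P_part.
  by rewrite -(def_pblock triv AP yA) (def_pblock triv BP yB).
- by move=> x /mem_ps/setDP[].
rewrite gapE ltnNge; apply: contra unmatched => le_W.
have W_split : #|W| = #|W :\: U| + #|U|.
  have /setIidPr WU : U \subset W by apply/subsetP => x; rewrite inE => /andP[].
  by rewrite -(cardsID U W) WU addnC.
have WE : W = [set x in flatten ps ++ enum U].
  apply/setP => x; rewrite inE mem_cat mem_enum; apply/idP/orP => [xW|[/mem_ps/setDP[]|]] //.
    have [xU|xU] := boolP (x \in U); [by right | left].
    have : x \in W :\: U by rewrite inE xU.
    rewrite -(cover_partition P_part) => /bigcupP[B BP xB].
    by apply/flattenP; exists (enum B); rewrite ?mem_enum //; apply: map_f; rewrite mem_enum.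
  by rewrite inE => /andP[].
rewrite WE; apply: matchable_cliques => //.
- rewrite cat_uniq ps_uniq enum_uniq andbT; apply/hasPn => x; rewrite mem_enum => xU.
  by apply/negP => /mem_ps/setDP[_]; rewrite xU.
- move=> _ /mapP[B + ->]; rewrite mem_enum => BP x y; rewrite !mem_enum => xB yB xDy.
  by have := block_eqg B x y BP xB (block_sub B y BP yB); rewrite yB /= (negPf xDy).
- move=> x y; rewrite mem_enum inE => /andP[_ /forallP univ] y_in xDy.
  have yW : y \in W by rewrite WE inE.
  by have /implyP/(_ yW)/implyP/(_ xDy) := univ y.
- by rewrite -cardE -(leq_add2l #|W :\: U|) -W_split -size_ps.
by rewrite size_cat size_ps -cardE -W_split.
Qed.

Theorem tutte_obstruction g W : symmetric g -> irreflexive g -> ~~ matchable g W ->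
  exists ps, [/\ multipartite (nonadj g) ps, {subset flatten ps <= W} & #|W| < gap ps].
Proof.
move=> g_sym g_irr; have [odd_W _|even_W] := boolP (odd #|W|).
  exists [:: enum W]; rewrite gapE /= cats0 -cardE odd_W addn0 addn1 ltnS leqnn.
  by split=> // [|x]; rewrite ?mem_enum // /multipartite /= cats0 enum_uniq.
pose missing r := [set p : T * T | [&& p.1 \in W, p.2 \in W, p.1 != p.2 & ~~ r p.1 p.2]].
have [n] := ubnP #|missing g|; elim: n g g_sym g_irr => // n IHn g g_sym g_irr lt_n unmatched.
have [/existsP[a /existsP[c /and5P[aW cW aDc ngac unmatched']]]|maximal] := boolP
    [exists a, exists c, [&& a \in W, c \in W, a != c, ~~ g a c & ~~ matchable (link g a c) W]].
  have [|||ps [ps_ok psW lt_W]] := IHn (link g a c) _ _ _ unmatched'.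
  - exact: link_sym.
  - exact: link_irr.
  - apply: leq_trans (_ : #|missing g| <= n); last by rewrite -ltnS.
    apply: proper_card; apply/properP; split.
      by apply/subsetP => p; rewrite !inE => /and4P[-> -> -> /norP[->]].
    by exists (a, c); rewrite !inE aW cW aDc //= /link /= !eqxx orbT.
  exists ps; split=> //; move: ps_ok; rewrite /multipartite => /andP[-> /=].
  apply: sub_pairwise => p q /allP pq; apply/allP => x /pq/allP xq; apply/allP => y /xq.
  by rewrite /nonadj /link /= negb_or => /andP[].
apply: maximal_obstruction => // a c aW cW aDc ngac; apply: contraNT maximal => unmatched'.
by apply/existsP; exists a; apply/existsP; exists c; rewrite aW cW aDc ngac.
Qed.
End Matchings.

Lemma multipartiteP (T : finType) (r : rel T) ps p q x y : symmetric r -> multipartite r ps ->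
  p \in ps -> q \in ps -> p != q -> x \in p -> y \in q -> r x y.
Proof.
move=> r_sym /andP[_]; elim: ps => //= p' ps IHps /andP[/allP p'_ps ps_ok].
rewrite !inE => /orP[/eqP->|p_in] /orP[/eqP->|q_in].
- by rewrite eqxx.
- by move=> _ xp yq; have /allP/(_ _ xp)/allP/(_ _ yq) := p'_ps q q_in.
- by move=> _ xp yq; rewrite r_sym; have /allP/(_ _ yq)/allP/(_ _ xp) := p'_ps p p_in.
exact: IHps.
Qed.

Section PerfectMatchings.
Variables (T : finType) (g : rel T).
Hypotheses (g_sym : symmetric g) (g_irr : irreflexive g).

Lemma matchable_perfect W : matchable g W -> exists M, perfect_matching g W M.
Proof.
case/matchableP=> m m_ok; exists [set [set x; m x] | x in W]; apply/andP; split.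
  apply/subsetP => _ /imsetP[x /m_ok[_ _ gm] ->].
  by apply/imsetP; exists (x, m x); rewrite ?inE.
apply/and3P; split.
- rewrite eqEsubset; apply/andP; split; apply/subsetP => x.
    by case/bigcupP=> _ /imsetP[y yW ->]; rewrite !inE; case/m_ok: (yW) => ? _ _ /orP[]/eqP->.
  by move=> xW; apply/bigcupP; exists [set x; m x]; rewrite ?set21 //; apply/imsetP; exists x.
- apply/trivIsetP => _ _ /imsetP[x xW ->] /imsetP[y yW ->]; apply: contraR => /pred0Pn[v].
  have [_ mmx _] := m_ok x xW; have [_ mmy _] := m_ok y yW.
  rewrite /= !inE => /andP[/orP[]/eqP-> /orP[]/eqP vE].
  + by rewrite vE.
  + by rewrite vE mmy setUC.
  + by rewrite -vE mmx setUC.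
  by rewrite -mmx vE mmy.
by apply/imsetP => -[x _ /setP/(_ x)]; rewrite !inE eqxx.
Qed.

Lemma perfect_matchable W M : perfect_matching g W M -> matchable g W.
Proof.
case/andP=> /subsetP M_edges M_part; have /and3P[/eqP M_cover M_triv _] := M_part.
have pairP x : x \in W -> exists y, [/\ y \in W, g x y & pblock M x = [set x; y]].
  rewrite -M_cover => xM; have BM := pblock_mem xM; have xB : x \in pblock M x by rewrite mem_pblock.
  have /imsetP[[a b] gab BE] := M_edges _ BM; rewrite inE /= in gab BE.
  have in_cover y : y \in pblock M x -> y \in cover M by move=> yB; apply/bigcupP; exists (pblock M x).
  have := xB; rewrite BE !inE => /orP[]/eqP xE; [exists b | exists a]; rewrite in_cover ?BE ?xE ?inE ?eqxx ?orbT //.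
  by rewrite g_sym setUC.
have pairP' x : exists y, x \in W -> [/\ y \in W, g x y & pblock M x = [set x; y]].
  by have [/pairP[y ?]|_] := boolP (x \in W); [exists y | exists x].
have [m m_ok] := fin_all_exists pairP'; apply/matchableP; exists m => x xW.
have [mW gm BE] := m_ok x xW; have [mmW gmm BE'] := m_ok _ mW; split=> //.
have : m (m x) \in pblock M x.
  have -> : pblock M x = pblock M (m x); last by rewrite BE' !inE eqxx orbT.
  apply/esym/(same_pblock M_triv); first by rewrite BE !inE eqxx orbT.
rewrite BE !inE => /orP[/eqP //|/eqP mmx].
by move: gmm; rewrite mmx g_irr.
Qed.

Lemma gap_le_matchable W ps : matchable g W -> multipartite (nonadj g) ps ->
  {subset flatten ps <= W} -> gap ps <= #|W|.
Proof.
case/matchableP=> m m_ok /andP[ps_uniq ps_sep] psW.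
have even_closed (p : seq T) : uniq p -> {subset p <= W} -> {in p, forall x, m x \in p} -> ~~ odd (size p).
  have [n] := ubnP (size p); elim: n p => // n IHn [|x p] //= lt_n /andP[x_p p_uniq] pW p_m.
  have xW : x \in W by apply: pW; rewrite mem_head.
  have [_ mmx gm] := m_ok x xW.
  have mx_p : m x \in p.
    by have := p_m x (mem_head _ _); rewrite inE; case: eqP => // mx; move: gm; rewrite mx g_irr.
  have p_size := size_rem mx_p; have : 0 < size p by case: (p) mx_p.
  case: (size p) p_size lt_n => // k p_size lt_n _; rewrite /= negbK -[k]/k.+1.-1 -p_size.
  apply: IHn => [||y|y].
  - by rewrite p_size; apply: ltnW.
  - exact: rem_uniq.
  - by move=> y_in; apply: pW; rewrite inE (mem_rem y_in) orbT.
  rewrite !mem_rem_uniq // !inE => /andP[yDmx y_p].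
  have yW : y \in W by apply: pW; rewrite inE y_p orbT.
  have [_ mmy _] := m_ok y yW.
  have := p_m y; rewrite !inE y_p orbT => /(_ isT) /orP[/eqP my|->].
    by case/eqP: yDmx; rewrite -mmy my.
  by rewrite andbT; apply: contraNneq x_p => my; rewrite -mmx -my mmy.
pose leaves := [seq x <- flatten ps | m x \notin flatten ps].
have m_inj : {in W &, injective m}.
  by move=> x y /m_ok[_ mmx _] /m_ok[_ mmy _] mxy; rewrite -mmx mxy mmy.
have leaves_uniq : uniq (flatten ps ++ map m leaves).
  rewrite cat_uniq ps_uniq map_inj_in_uniq ?filter_uniq // ?andbT.
    by apply/hasPn => _ /mapP[x + ->]; rewrite mem_filter => /andP[].
  by move=> x y; rewrite !mem_filter => /andP[_ /psW xW] /andP[_ /psW yW]; apply: m_inj.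
rewrite gapE cardE; apply: leq_trans (uniq_leq_size leaves_uniq _); last first.
  move=> y; rewrite mem_enum mem_cat => /orP[/psW//|/mapP[x + ->]].
  by rewrite mem_filter => /andP[_ /psW/m_ok[]].
rewrite size_cat size_map leq_add2l size_filter.
have: {subset ps <= ps} by [].
elim: {1 3 5}ps => //= p qs IHqs sub.
rewrite count_cat leq_add ?IHqs // => [|q q_in]; last by apply: sub; rewrite inE q_in orbT.
have p_in : p \in ps by apply: sub; rewrite mem_head.
have p_sub : {subset p <= flatten ps} by move=> x xp; apply/flattenP; exists p.
case odd_p: (odd _) => //; rewrite -has_count.
have p_uniq : uniq p.
  have [s1 [s2 psE]] : exists s1 s2, ps = s1 ++ p :: s2 by case/splitPr: p_in => s1 s2; exists s1, s2.
  by move: ps_uniq; rewrite psE flatten_cat /= cat_uniq cat_uniq => /and4P[_ _].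
apply: contraTT odd_p => /hasPn stay; apply: even_closed => // [x xp|x xp].
  exact/psW/p_sub.
have := stay x xp; rewrite negbK => /flattenP[q q_in mxq].
have [->//|pDq] := eqVneq p q.
have [_ _ gm] := m_ok x (psW _ (p_sub _ xp)).
have sep_sym : symmetric (nonadj g) by move=> u v; rewrite /nonadj /= g_sym.
have sep : multipartite (nonadj g) ps by rewrite /multipartite ps_uniq ps_sep.
by have := multipartiteP sep_sym sep p_in q_in pDq xp mxq; rewrite /nonadj /= gm.
Qed.
End PerfectMatchings.

(** * Minimal critical graphs and their complements *)

Fixpoint trim (T : Type) (n : nat) (ps : seq (seq T)) : seq (seq T) :=
  if ps is p :: ps' then
    let k := minn n (uphalf (size p)) in
    if k is k'.+1 then take k'.*2.+1 p :: trim (n - k) ps' else trim n ps'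
  else [::].

Section Trim.
Variables (T : finType) (r : rel T).
Implicit Type ps : seq (seq T).

Lemma trim_sub n ps : {subset flatten (trim n ps) <= flatten ps}.
Proof.
elim: ps n => //= p ps IHps n x; case: (minn _ _) => [|k] /=.
  by move/IHps; rewrite mem_cat => ->; rewrite orbT.
by rewrite !mem_cat => /orP[/mem_take->//|/IHps->]; rewrite orbT.
Qed.

Lemma trim_multipartite n ps : multipartite r ps -> multipartite r (trim n ps).
Proof.
rewrite /multipartite; elim: ps n => //= p ps IHps n.
rewrite cat_uniq => /and3P[/and3P[p_uniq /hasPn disj ps_uniq] /allP p_ps ps_ok].
have := IHps; rewrite ps_uniq ps_ok => {}IHps.
case: (minn _ _) => [|k] /=; first exact: IHps.
have /andP[t_uniq ->] := IHps (n - k.+1) isT; rewrite cat_uniq take_uniq // t_uniq andbT /=.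
apply/andP; split.
  by apply/hasPn => x /trim_sub /disj; apply: contra => /mem_take.
rewrite andbT; apply/allP => q q_in; apply/allP => x /mem_take xp; apply/allP => y yq.
have /flattenP[q' q'_in yq'] : y \in flatten ps by apply: (@trim_sub (n - k.+1)); apply/flattenP; exists q.
by have /allP/(_ _ xp)/allP/(_ _ yq') := p_ps q' q'_in.
Qed.

Lemma size_trim n ps : n.*2 <= gap ps ->
  all (fun p => odd (size p)) (trim n ps) /\ sumn [seq uphalf (size p) | p <- trim n ps] = n.
Proof.
elim: ps n => [|p ps IHps] n /=; first by rewrite leqn0 double_eq0 => /eqP->.
rewrite /gap /= => le_n; case kE: (minn n (uphalf (size p))) => [|k] /=.
  have [n0|n_gt0] := posnP n; first by apply: IHps; rewrite n0.
  apply: IHps; apply: leq_trans le_n _; rewrite /gap.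
  by move: kE n_gt0; rewrite /minn; case: ifP => _ ->.
have [|all_odd sum_odd] := IHps (n - k.+1).
  by move: le_n kE; rewrite /gap; lia.
have size_take_p : size (take k.*2.+1 p) = k.*2.+1 by rewrite size_takel //; lia.
by rewrite size_take_p all_odd sum_odd; split; lia.
Qed.
End Trim.

(* The exception for parts of size 1 is the part {u} or {w}: its vertex lacks the edge uw
   in h. *)
Definition degree_ok (sh : seq nat) : bool :=
  all (fun i => sumn sh - nth 0 sh i <= if (i < 2) && (nth 0 sh i == 1) then 8 else 7)
    (iota 0 (size sh)).

Fixpoint compositions (fuel n : nat) : seq (seq nat) :=
  if n == 0 then [:: [::]] else
  if fuel is fuel'.+1 then
    flatten [seq [seq k :: l | l <- compositions fuel' (n - k)] | k <- iota 1 n]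
  else [::].

Lemma mem_compositions fuel c : all (leq 1) c -> sumn c <= fuel -> c \in compositions fuel (sumn c).
Proof.
elim: c fuel => [|k c IHc] [|fuel] //= /andP[k_gt0 c_gt0] le_fuel; first by lia.
have -> : (k + sumn c == 0) = false by lia.
apply/flattenP; exists [seq k :: l | l <- compositions fuel (k + sumn c - k)].
  by apply/mapP; exists k; rewrite // mem_iota; lia.
by apply/map_f; rewrite addKn; apply: IHc => //; lia.
Qed.

Lemma shape_cases sh : all odd sh -> sumn (map uphalf sh) = 6 -> 1 < size sh ->
  sorted leq (drop 2 sh) -> degree_ok sh -> sh \in shapes.
Proof.
move=> sh_odd sh_sum sh_gt1 sh_sorted sh_deg.
have shE : sh = [seq c.*2.-1 | c <- map uphalf sh].
  rewrite -map_comp -[LHS]map_id; apply/eq_in_map => s /(allP sh_odd) odd_s /=; lia.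
have c_pos : all (leq 1) (map uphalf sh).
  by apply/allP => _ /mapP[s /(allP sh_odd) odd_s ->]; lia.
have := mem_compositions (fuel := 6) c_pos; rewrite sh_sum => /(_ isT).
have /allP check : all (fun c => let sh := [seq c.*2.-1 | c <- c] in
    [&& 1 < size sh, sorted leq (drop 2 sh) & degree_ok sh] ==> (sh \in shapes)) (compositions 6 6).
  by vm_compute.
by move=> /check /=; rewrite -shE sh_gt1 sh_sorted sh_deg.
Qed.

Lemma pattern_degree_ok (T : finType) (h : rel T) sh f u w :
  neighbours_le h 7 -> colouring (link h u w) sh f -> f u = 0 -> f w = 1 -> 1 < size sh ->
  ~~ h u w -> all odd sh -> degree_ok sh.
Proof.
move=> h_deg col fu fw sh_gt1 nhuw sh_odd; apply/allP => i; rewrite mem_iota /= => lt_i.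
have [_ fc _] := col.
have bound v : f v = i -> sumn sh - nth 0 sh i <= 7 + (v \in [:: u; w]).
  move=> fv; rewrite -fv in lt_i *.
  exact: leq_trans (leq_addl _ _) (spoils_others_le h_deg col fu fw lt_i).
have odd_i : odd (nth 0 sh i) by apply: (allP sh_odd); rewrite mem_nth.
have /card_gt0P[v] : 0 < #|[pred a | f a == i]| by rewrite fc //; case: (nth 0 sh i) odd_i.
rewrite inE => /eqP fv; case: ifP => [_|small].
  by apply: leq_trans (bound v fv) _; rewrite -[8]/(7 + 1) leq_add2l leq_b1.
have [v' fv' v'_new] : exists2 v', f v' = i & v' \notin [:: u; w].
  have [lt_i2|le_2i] := ltnP i 2; last first.
    exists v => //; rewrite !inE; apply/norP; split; apply: contraTneq le_2i => vE;
      by rewrite -fv vE ?fu ?fw.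
  rewrite lt_i2 /= in small; pose t := if i == 0 then u else w.
  have ft : f t = i by rewrite /t; case: eqP => [->//|i0]; rewrite fw; lia.
  have : 0 < #|[pred a | (a != t) && (f a == i)]|.
    have := cardD1 t [pred a | f a == i]; rewrite fc // inE ft eqxx add1n => sizeE.
    rewrite (eq_card (B := [predD1 [pred a | f a == i] & t])) => [|a]; last by rewrite !inE.
    by case: (#|_|) sizeE => // size1; rewrite size1 in small.
  case/card_gt0P=> v'; rewrite inE => /andP[v'Dt /eqP fv']; exists v' => //.
  rewrite !inE negb_or; move: v'Dt; rewrite /t; case: (i =P 0) => i0 ->; rewrite ?andbT /=.
    by apply/eqP => v'w; move: fv'; rewrite v'w fw i0.
  by apply/eqP => v'u; move: fv'; rewrite v'u fu => /esym.
by have := bound v' fv'; rewrite (negPf v'_new) addn0.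
Qed.

Lemma nth_flatten_inj (S : eqType) (ps : seq (seq S)) i j a : uniq (flatten ps) ->
  a \in nth [::] ps i -> a \in nth [::] ps j -> i = j.
Proof.
have in_flatten (qs : seq (seq S)) k : a \in nth [::] qs k -> a \in flatten qs.
  have [lt_k|le_k] := ltnP k (size qs); last by rewrite nth_default.
  by move=> a_in; apply/flattenP; exists (nth [::] qs k); rewrite ?mem_nth.
elim: ps i j => [|p ps IHps] [|i] [|j] //=; rewrite cat_uniq => /and3P[_ /hasPn disj ps_uniq].
- by move=> ap /in_flatten/disj; rewrite ap.
- by move=> /in_flatten/disj + ap; rewrite ap.
by move=> ai aj; congr _.+1; apply: IHps.
Qed.

Lemma find_flatten (S : eqType) (ps : seq (seq S)) i a : uniq (flatten ps) -> i < size ps ->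
  (find (fun s : seq S => a \in s) ps == i) = (a \in nth [::] ps i).
Proof.
move=> ps_uniq lt_i; apply/eqP/idP => [fi|ai].
  rewrite -fi; apply: (nth_find [::] (a := fun s : seq S => a \in s)).
  by rewrite has_find fi.
have has_a : has (fun s : seq S => a \in s) ps.
  by apply/hasP; exists (nth [::] ps i); rewrite ?mem_nth.
exact: nth_flatten_inj ps_uniq (nth_find [::] has_a) ai.
Qed.

Lemma multipartite_pattern (T : finType) (h : rel T) ps p q u w :
  symmetric h -> multipartite (link h u w) ps -> p \in ps -> q \in ps -> p != q ->
  u \in p -> w \in q -> exists sh f,
    [/\ colouring (link h u w) sh f, f u = 0 /\ f w = 1, 1 < size sh, sorted leq (drop 2 sh) &
      perm_eq sh (map size ps)].
Proof.
move=> h_sym ps_ok p_in q_in pDq up wq.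
have l_sym : symmetric (link h u w) by apply: link_sym.
have adj := multipartiteP l_sym ps_ok.
have /andP[flat_uniq _] := ps_ok.
pose part i := nth [::] ps i; pose idx a := find (fun s : seq T => a \in s) ps.
have idxP a i : i < size ps -> (idx a == i) = (a \in part i) by apply: find_flatten.
pose i0 := index p ps; pose i1 := index q ps.
have lt_i0 : i0 < size ps by rewrite index_mem.
have lt_i1 : i1 < size ps by rewrite index_mem.
have part0 : part i0 = p by apply: nth_index.
have part1 : part i1 = q by apply: nth_index.
have i0Di1 : i0 != i1 by apply: contraNneq pDq => ii; rewrite -part0 ii part1.
pose by_size := relpre (fun i => size (part i)) leq.
pose others := sort by_size [seq i <- iota 0 (size ps) | i \notin [:: i0; i1]].
pose o := [:: i0, i1 & others].
have mem_o i : (i \in o) = (i < size ps).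
  rewrite !inE mem_sort mem_filter mem_iota !inE negb_or /=.
  have [->|_] := eqVneq i i0; first by rewrite lt_i0.
  by have [->|_] := eqVneq i i1; first by rewrite lt_i1.
have o_uniq : uniq o.
  by rewrite /= !inE !mem_sort !mem_filter !inE !eqxx orbT negb_or i0Di1 sort_uniq filter_uniq ?iota_uniq.
have o_perm : perm_eq o (iota 0 (size ps)).
  by apply: uniq_perm; rewrite ?iota_uniq // => i; rewrite mem_o mem_iota.
have partsE : map part (iota 0 (size ps)) = ps.
  by apply: (@eq_from_nth _ [::]); rewrite ?size_map ?size_iota // => i lt_i;
    rewrite (nth_map 0) ?size_iota // nth_iota.
exists [seq size (part i) | i <- o], (fun a => index (idx a) o); split=> //.
- split=> [a|i|a b].
  + by rewrite size_map index_size.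
  + rewrite size_map => lt_i; rewrite (nth_map 0) //.
    have lt_o : nth 0 o i < size ps by rewrite -mem_o mem_nth.
    have part_uniq : uniq (part (nth 0 o i)).
      move: flat_uniq; rewrite -(cat_take_drop (nth 0 o i) ps) (drop_nth [::]) //.
      by rewrite flatten_cat /= cat_uniq cat_uniq => /and4P[].
    rewrite -(card_uniqP part_uniq); apply: eq_card => a; rewrite !inE -idxP //.
    apply/eqP/eqP => [ia|->]; last by rewrite index_uniq.
    by rewrite -ia nth_index // -index_mem ia.
  rewrite size_map !index_mem !mem_o => lt_a lt_b neq.
  apply: (adj (part (idx a)) (part (idx b))); rewrite ?mem_nth // -?idxP ?eqxx //.
  apply: contraNneq neq => partE; apply/eqP; congr (index _ o); apply/eqP.
  by rewrite idxP // -partE -idxP.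
- split; rewrite /=.
    by rewrite (eqP (_ : idx u == i0)) ?eqxx // idxP ?part0.
  by rewrite (eqP (_ : idx w == i1)) ?idxP ?part1 // (negPf i0Di1) eqxx.
- by rewrite /= drop0 sorted_map sort_sorted // => i j; apply: leq_total.
by rewrite -[in X in perm_eq _ X]partsE -map_comp; apply: perm_map.
Qed.

Section Complement.
Variables (T : finType) (e : rel T).
Hypotheses (e_sym : symmetric e) (e_irr : irreflexive e) (T_ge12 : 12 <= #|T|).
Local Notation k := (#|T| - 10).

Definition complement : rel T := [rel x y | (x != y) && ~~ e x y].

Lemma complement_sym : symmetric complement.
Proof. by move=> x y; rewrite /complement /= eq_sym e_sym. Qed.

Lemma complement_irr : irreflexive complement.
Proof. by move=> x; rewrite /complement /= eqxx. Qed.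

Lemma multipartite_sub (r r' : rel T) (ps : seq (seq T)) :
  (forall (p q : seq T) x y, p \in ps -> q \in ps -> p != q -> x \in p -> y \in q -> x != y ->
     r x y -> r' x y) ->
  multipartite r ps -> multipartite r' ps.
Proof.
rewrite /multipartite; elim: ps => //= p ps IHps sub.
rewrite cat_uniq => /and3P[/and3P[p_uniq /hasPn disj ps_uniq] /allP p_ps ps_ok].
have {}IHps : pairwise (fun p q => all (fun a => all (r' a) q) p) ps.
  have [|//|_ ->//] := andP (IHps _ _); last by rewrite ps_uniq.
  by move=> p1 q1 x y p1_in q1_in; apply: sub; rewrite inE ?p1_in ?q1_in orbT.
rewrite p_uniq ps_uniq IHps !andbT /=; apply/andP; split; first by apply/hasPn.
apply/allP => q q_in; apply/allP => x xp; apply/allP => y yq.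
have yf : y \in flatten ps by apply/flattenP; exists q.
have yNp := disj y yf.
have /allP/(_ _ xp)/allP/(_ _ yq) := p_ps q q_in; have pDq : p != q by apply: contraNneq yNp => ->.
have xDy : x != y by apply: contraNneq yNp => <-.
by apply: (sub p q x y _ _ pDq xp yq xDy); rewrite inE ?eqxx ?q_in ?orbT.
Qed.

Lemma gap_odd (ps : seq (seq T)) : all (fun p => odd (size p)) ps ->
  gap ps = size (flatten ps) + size ps.
Proof. by move=> odd_ps; rewrite gapE; congr (_ + _); apply/eqP; rewrite -all_count. Qed.

Lemma critical_gap ps : factor_critical e k -> multipartite complement ps ->
  all (fun p => odd (size p)) ps -> 1 < size ps -> gap ps <> 12.
Proof.
case=> _ crit ps_ok ps_odd ps_gt1 gap12.
have ps_size : size (flatten ps) <= 10 by move: gap12; rewrite gap_odd //; lia.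
have ps_uniq : uniq (flatten ps) by case/andP: ps_ok.
have [W psW W10] : exists2 W : {set T}, {subset flatten ps <= W} & #|W| = 10.
  pose s := flatten ps ++ [seq x <- enum T | x \notin flatten ps].
  have s_uniq : uniq s.
    rewrite cat_uniq ps_uniq filter_uniq ?enum_uniq // andbT.
    by apply/hasPn => x; rewrite mem_filter => /andP[].
  have s_size : size s = #|T|.
    rewrite -(card_uniqP s_uniq); apply: eq_card => x.
    by rewrite !inE mem_cat mem_filter mem_enum andbT orbN.
  exists [set x in take 10 s] => [x xps|].
    by rewrite inE /s take_cat ltnNge ps_size /= mem_cat xps.
  rewrite cardsE (card_uniqP (take_uniq 10 s_uniq)) size_takel // s_size.
  exact: leq_trans T_ge12.
have [|M /(perfect_matchable e_sym e_irr)] := crit (~: W).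
  by rewrite cardsCs setCK W10.
rewrite setCK => /(gap_le_matchable e_sym e_irr)/(_ _ psW); rewrite gap12 W10.
have sep : multipartite (nonadj e) ps.
  by apply: multipartite_sub ps_ok => p q x y _ _ _ _ _ _ /andP[].
by move=> /(_ sep).
Qed.

Lemma critical_family_free : factor_critical e k -> family_free complement.
Proof.
move=> crit ps shape_in; apply/negP => ps_ok.
have /allP check : all (fun sh => [&& all odd sh, 1 < size sh & sumn [seq (uphalf n).*2 | n <- sh] == 12])
  family by [].
have /and3P[sh_odd sh_gt1 /eqP sh12] := check _ shape_in.
apply: (critical_gap crit ps_ok); rewrite ?size_map // in sh_gt1 *.
  by move: sh_odd; rewrite all_map.
by move: sh12; rewrite -map_comp.
Qed.

Lemma minimal_saturated : minimal_factor_critical e k -> neighbours_le complement 7 ->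
  saturated complement shapes.
Proof.
case=> crit minimal h_deg u w uDw nhuw.
have h_sym := complement_sym; have h_irr := complement_irr.
have euw : e u w by move: nhuw; rewrite /complement /= uDw negbK.
pose f := [set u; w]; pose e' := del_edge e f.
have e'_sym : symmetric e' by move=> x y; rewrite /e' /del_edge /= e_sym setUC.
have e'_irr : irreflexive e' by move=> x; rewrite /e' /del_edge /= e_irr.
have [W W10 unmatched] : exists2 W : {set T}, #|W| = 10 & ~~ matchable e' W.
  have f_edge : f \in edges e by apply/imsetP; exists (u, w); rewrite ?inE.
  have [/existsP[S /andP[/eqP Sk unmatched]]|all_matched] :=
      boolP [exists S : {set T}, (#|S| == k) && ~~ matchable e' (~: S)].
    exists (~: S) => //; rewrite cardsCs setCK Sk; lia.
  case: (minimal f f_edge); split; first by case: crit.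
  move=> S Sk; apply: matchable_perfect => //.
  have := existsPn all_matched S; rewrite Sk eqxx /= negbK.
  exact: id.
have [ps [sep psW lt_gap]] := tutte_obstruction e'_sym e'_irr unmatched.
have gap_ge12 : 6.*2 <= gap ps.
  have : ~~ odd (gap ps) by rewrite /gap; elim: (ps) => //= p qs; rewrite oddD odd_double.
  by move: lt_gap; rewrite W10; lia.
have ps_link : multipartite (link complement u w) ps.
  apply: multipartite_sub sep => _ _ x y _ _ _ _ _ xDy; rewrite /nonadj /e' /del_edge /link /complement /= xDy.
  rewrite negb_and negbK => /orP[->//|/eqP xy].
  have : (x \in f) && (y \in f) by rewrite -xy !inE !eqxx orbT.
  rewrite /f !inE => /andP[/orP[]/eqP xE /orP[]/eqP yE]; rewrite xE yE !eqxx ?orbT //;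
    by move: xDy; rewrite xE yE eqxx.
pose qs := trim 6 ps.
have [qs_odd qs_sum] := size_trim gap_ge12.
have qs_link : multipartite (link complement u w) qs by apply: trim_multipartite.
have qs_size : size (flatten qs) <= 10.
  rewrite -W10 cardE; apply: uniq_leq_size; first by case/andP: qs_link.
  by move=> x /trim_sub/psW; rewrite mem_enum.
have qs_gap : gap qs = 12.
  by rewrite /gap -[12]/(6.*2) -qs_sum -/qs; elim: (qs) => //= p rs; rewrite doubleD => ->.
have qs_gt1 : 1 < size qs by move: qs_gap; rewrite gap_odd //; lia.
have [/hasP[p p_in /hasP[q q_in /and3P[pDq up wq]]]|same] :=
  boolP (has (fun p => has (fun q : seq T => [&& p != q, u \in p & w \in q]) qs) qs).
  have [sh [g [col [gu gw] sh_gt1 sh_sorted sh_perm]]] :=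
    multipartite_pattern h_sym qs_link p_in q_in pDq up wq.
  have sh_odd : all odd sh by rewrite (perm_all _ sh_perm) all_map.
  exists sh; last by exists g.
  apply: shape_cases => //.
    by rewrite (perm_sumn (perm_map uphalf sh_perm)) -map_comp.
  exact: (pattern_degree_ok h_deg col).
case: (critical_gap crit _ qs_odd qs_gt1 qs_gap).
apply: multipartite_sub qs_link => p q x y p_in q_in pDq xp yq xDy.
have apart p' q' : p' \in qs -> q' \in qs -> p' != q' -> u \in p' -> w \in q' -> false.
  move=> p'_in q'_in p'Dq' up wq; move/hasPn: same => /(_ _ p'_in)/hasPn/(_ _ q'_in).
  by rewrite p'Dq' up wq.
case/or3P=> [//|/andP[/eqP xu /eqP yw]|/andP[/eqP xw /eqP yu]].
  by have := apart p q p_in q_in pDq; rewrite -xu -yw xp yq => /(_ isT isT).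
by have := apart q p q_in p_in; rewrite eq_sym pDq -yu -xw xp yq => /(_ isT isT isT).
Qed.

Lemma degree_complement x : degree e x + #|[pred y | complement x y]| = #|T|.-1.
Proof.
have disj : [predI e x & [pred y | complement x y]] =i pred0.
  by move=> y; rewrite !inE /complement /= [y \in _]unfold_in; case: (e x y); rewrite ?andbF.
have -> : degree e x = #|e x| by rewrite /degree cardsE.
rewrite -cardUI (eq_card0 disj).
rewrite addn0 -(cardC1 x); apply: eq_card => y; rewrite !inE /complement /= [y \in e x]unfold_in eq_sym.
by have [->|_] := eqVneq y x; rewrite ?e_irr //= orbN.
Qed.

Lemma critical_complement_le8 : factor_critical e k -> neighbours_le complement 8.
Proof.
move=> crit x; rewrite leqNgt; apply/negP => lt8.
pose p := take 9 (enum [pred y | complement x y]).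
have p_size : size p = 9 by rewrite size_takel // -cardE.
have p_adj y : y \in p -> complement x y by move/mem_take; rewrite mem_enum.
apply: (critical_gap crit (ps := [:: [:: x]; p])); rewrite /= ?p_size //; last first.
  by rewrite /gap /= p_size.
rewrite /multipartite /= cats0 take_uniq ?enum_uniq // !andbT.
apply/andP; split; last by apply/allP.
by apply/negP => /p_adj; rewrite complement_irr.
Qed.
End Complement.

Lemma bigminn_le (I : eqType) (s : seq I) (F : I -> nat) d i : i \in s ->
  \big[minn/d]_(j <- s) F j <= F i.
Proof.
elim: s => //= j s IHs; rewrite inE big_cons => /predU1P[->|/IHs]; first exact: geq_minl.
exact: leq_trans (geq_minr _ _).
Qed.

Theorem theorem1p4 (T : finType) (e : rel T) (n : nat)
  (e_sym : symmetric e) (e_irr : irreflexive e)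
  (order_e : #|T| = n) (n_ge12 : 12 <= n)
  (e_min : minimal_factor_critical e (n - 10)) :
  min_degree e = n - 9.
Proof.
subst n; have crit : factor_critical e (#|T| - 10) by case: e_min.
have le8 := critical_complement_le8 e_sym e_irr n_ge12 crit.
have degE := degree_complement e_irr.
apply/eqP; rewrite eqn_leq; apply/andP; split; last first.
  rewrite /min_degree; apply: (big_ind (fun m => #|T| - 9 <= m)) => [|a b|x _].
  - exact: leq_subr.
  - by rewrite leq_min => -> ->.
  by have := degE x; have := le8 x; lia.
have [x le_x] : exists x, degree e x <= #|T| - 9.
  apply/existsP; apply: contraT => /existsPn big_deg.
  have le7 : neighbours_le (complement e) 7.
    by move=> x; have := degE x; have := big_deg x; lia.
  case: (not_saturated (complement_sym e_sym) (complement_irr e) le7 _ n_ge12).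
    exact: critical_family_free crit.
  exact: minimal_saturated.
by apply: leq_trans le_x; apply: bigminn_le; rewrite mem_index_enum.
Qed.
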